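(* Let $1<p<\infty$, let $q$ be the conjugate index to $p$, and let $G=\mathbb{R}\rtimes\mathbb{R}^\times$. Then $\Psi_p:L^p(\mathbb{R}^\times)\widehat{\otimes}L^q(\mathbb{R}^\times)\to C_0(G)$ is injective. Consequently, $\Psi_p:\mathcal{A}_p\to\mathrm{A}^p_\pi$ is an isometric isomorphism of Banach algebras, where $\mathrm{A}^p_\pi$ carries the pointwise product.
   Context: $\mathbb{R}^\times$ is the multiplicative group of non-zero reals with Haar measure $dt/|t|$, and $L^p(\mathbb{R}^\times)$ is taken with respect to this measure; $\widehat{\otimes}$ is the projective tensor product of Banach spaces. $G=\mathbb{R}\rtimes\mathbb{R}^\times=\{(b,a):b\in\mathbb{R},a\in\mathbb{R}^\times\}$ with the product topology and multiplication $(b,a)(b',a')=(ab'+b,aa')$. $\mathcal{A}_p$ is the commutative Banach algebra with underlying Banach space $L^p(\mathbb{R}^\times)\widehat{\otimes}L^q(\mathbb{R}^\times)$ and product $\boxtimes$, the unique contractive bilinear map satisfying, for $\xi,\xi'\in L^p(\mathbb{R}^\times)$ and $\eta,\eta'\in L^q(\mathbb{R}^\times)$, $$(\xi\otimes\eta)\boxtimes(\xi'\otimes\eta')=\int_{\mathbb{R}^\times}\bigl(\lambda(1+h)\xi\cdot\lambda(1+h^{-1})\xi'\bigr)\otimes\bigl(\lambda(1+h)\eta\cdot\lambda(1+h^{-1})\eta'\bigr)\,\frac{dh}{|h|}$$ (a Bochner integral in $L^p(\mathbb{R}^\times)\widehat{\otimes}L^q(\mathbb{R}^\times)$), where $(\lambda(r)\xi)(t)=\xi(r^{-1}t)$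 and $f\cdot g$ is the pointwise product. $\Psi_p$ is the contractive linear map on $L^p(\mathbb{R}^\times)\widehat{\otimes}L^q(\mathbb{R}^\times)$ determined by $$\Psi_p(\xi\otimes\eta)(b,a)=\int_{\mathbb{R}^\times}e^{2\pi i bt}\xi(ta)\eta(t)\,\frac{dt}{|t|}\qquad((b,a)\in G);$$ its range lies in $C_0(G)$. $\mathrm{A}^p_\pi$ denotes the range of $\Psi_p$, equipped with the quotient norm from $\mathcal{A}_p/\ker\Psi_p$. *)

(* Defs.v *)
From HB Require Import structures.
From mathcomp Require Import all_boot all_order all_algebra.
From mathcomp Require Import all_classical all_reals all_analysis measurable_realfun.
From mathcomp Require Import complex.
Set Implicit Arguments.
Unset Strict Implicit.
Unset Printing Implicit Defensive.
Import Order.TTheory GRing.Theory Num.Theory numFieldNormedType.Exports.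
Local Open Scope classical_set_scope.
Local Open Scope ring_scope.
Local Open Scope complex_scope.

Local Notation Re := (@complex.Re _).
Local Notation Im := (@complex.Im _).
Local Notation normc := (@Normc.normc _).

(* [R[i]]-normed spaces carry an [R[i]]-valued norm; [rnorm] is the same norm
   seen in [R]. *)
Definition rnorm (R : realType) (V : normedModType R[i]) (v : V) : R := Re `|v|.

(* The library's L^p spaces are real-valued; the complex-valued L^p(mu) is built
   here as the quotient of the p-integrable functions [T -> R[i]] by equality
   mu-almost everywhere.  The (unused) argument [1 <= p] in [cLfun] and
   [null_fun] keys their closure properties. *)
Section ComplexLp.
Context d (T : measurableType d) (R : realType).
Variable mu : {measure set T -> \bar R}.
Implicit Types f g : T -> R[i].

Definition cmeasurable f :=
  measurable_fun setT (fun t => Re (f t)) /\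
  measurable_fun setT (fun t => Im (f t)).

Definition cLnorm (p : R) f : \bar R := Lnorm mu p%:E (fun t => (normc (f t))%:E).

Lemma normc_ge0 (z : R[i]) : 0 <= normc z.
Proof. by case: z => a b; exact: sqrtr_ge0. Qed.

Lemma normcE (z : R[i]) : `|z| = (normc z)%:C.
Proof. by []. Qed.

Lemma ReD (x y : R[i]) : Re (x + y) = Re x + Re y.
Proof. by case: x; case: y. Qed.
Lemma ImD (x y : R[i]) : Im (x + y) = Im x + Im y.
Proof. by case: x; case: y. Qed.
Lemma ReM (x y : R[i]) : Re (x * y) = Re x * Re y - Im x * Im y.
Proof. by case: x; case: y. Qed.
Lemma ImM (x y : R[i]) : Im (x * y) = Re x * Im y + Im x * Re y.
Proof. by case: x; case: y. Qed.

Lemma measurable_normc f : cmeasurable f ->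
  measurable_fun setT (fun t => normc (f t)).
Proof.
move=> [mr mi].
have -> : (fun t => normc (f t)) =
    (@Num.sqrt R) \o (fun t => Re (f t) ^+ 2 + Im (f t) ^+ 2).
  by apply/funext => t /=; case: (f t).
apply: measurableT_comp.
  apply: continuous_measurable_fun; exact: sqrt_continuous.
by apply: measurable_funD; exact: measurable_funX.
Qed.

Lemma cmeasurable0 : cmeasurable 0.
Proof. by split; exact: measurable_cst. Qed.

Lemma cmeasurableD f g : cmeasurable f -> cmeasurable g -> cmeasurable (f + g).
Proof.
move=> [fr fi] [gr gi]; split.
  have -> : (fun t => Re ((f + g) t)) = (fun t => Re (f t)) \+ (fun t => Re (g t)).
    by apply/funext => t; rewrite -[(f + g) t]/(f t + g t) ReD.
  exact: measurable_funD.
have -> : (fun t => Im ((f + g) t)) = (fun t => Im (f t)) \+ (fun t => Im (g t)).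
  by apply/funext => t; rewrite -[(f + g) t]/(f t + g t) ImD.
exact: measurable_funD.
Qed.

Lemma cmeasurableZ a f : cmeasurable f -> cmeasurable (a *: f).
Proof.
move=> [fr fi]; split.
  have -> : (fun t => Re ((a *: f) t)) =
      (fun t => Re a * Re (f t)) \- (fun t => Im a * Im (f t)).
    by apply/funext => t; rewrite -[(a *: f) t]/(a * f t) ReM.
  by apply: measurable_funB; exact: measurable_funM.
have -> : (fun t => Im ((a *: f) t)) =
    (fun t => Re a * Im (f t)) \+ (fun t => Im a * Re (f t)).
  by apply/funext => t; rewrite -[(a *: f) t]/(a * f t) ImM.
by apply: measurable_funD; exact: measurable_funM.
Qed.

Variables (p : R) (p1 : 1 <= p).

Let p_gt0 : 0 < p. Proof. exact: lt_le_trans p1. Qed.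

Lemma cLnorm_le (f : T -> R[i]) (g : T -> R) : cmeasurable f ->
  measurable_fun setT g -> (forall t, normc (f t) <= g t) ->
  (cLnorm p f <= Lnorm mu p%:E (EFin \o g))%E.
Proof.
move=> mf mg fg; rewrite /cLnorm unlock /Lnorm.
have mpow (h : T -> R) : measurable_fun setT h ->
    measurable_fun setT (fun x => (`|(EFin \o h) x| `^ p)%E).
  move=> mh; rewrite (_ : (fun _ => _) = EFin \o (fun x => `|h x| `^ p))//.
  apply/measurable_EFinP; apply: (measurableT_comp (measurable_powR _)) => //.
  exact: measurableT_comp.
apply: gt0_ler_poweR.
- by rewrite invr_ge0 ltW.
- by rewrite in_itv/= leey andbT integral_ge0.
- by rewrite in_itv/= leey andbT integral_ge0.
apply: ge0_le_integral => //.
- by move=> t _; exact: poweR_ge0.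
- exact: (mpow (fun t => normc (f t)) (measurable_normc mf)).
- exact: mpow.
- move=> t _ /=; rewrite lee_fin; apply: ge0_ler_powR.
  + exact: ltW.
  + by rewrite nnegrE.
  + by rewrite nnegrE.
  + by rewrite ger0_norm ?normc_ge0// (le_trans (fg t))// ler_norm.
Qed.

Lemma cLnormD f g : cmeasurable f -> cmeasurable g ->
  (cLnorm p (f + g)%R <= cLnorm p f + cLnorm p g)%E.
Proof.
move=> mf mg; have mnf := measurable_normc mf; have mng := measurable_normc mg.
apply: le_trans (minkowski_EFin mu mnf mng p1).
apply: cLnorm_le; first exact: cmeasurableD.
  exact: measurable_funD.
by move=> t; exact: le_normcD.
Qed.

Lemma cLnormZ a f : cmeasurable f -> (cLnorm p f < +oo)%E ->
  cLnorm p (a *: f) = ((normc a)%:E * cLnorm p f)%E.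
Proof.
move=> mf ff; have mnf := measurable_normc mf.
have p1E : (1 <= p%:E)%E by rewrite lee_fin.
have fL : (fun t => normc (f t)) \in Lfun mu p%:E.
  by rewrite inE; apply/andP; split; rewrite inE.
have := LnormZ (Lfun_Sub p1E fL) (normc a).
rewrite ger0_norm ?normc_ge0// => <-; rewrite /cLnorm.
by apply: eq_Lnorm => t; congr EFin; exact: Normc.normcM.
Qed.

Definition cLfun of 1 <= p : {pred T -> R[i]} :=
  fun f => `[< cmeasurable f /\ (cLnorm p f < +oo)%E >].

Lemma cLfun_submod_closed : submod_closed (cLfun p1).
Proof.
split.
  apply/asboolP; split; first exact: cmeasurable0.
  rewrite /cLnorm (_ : (fun _ => _) = cst 0%E) ?Lnorm0 ?gt_eqF ?lte_fin//.
  by apply/funext => t; congr EFin; exact: Normc.normc0.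
move=> a f g /asboolP[mf ff] /asboolP[mg fg]; apply/asboolP.
have maf := cmeasurableZ a mf.
split; first exact: cmeasurableD.
apply: (le_lt_trans (cLnormD maf mg)); rewrite lte_add_pinfty//.
by rewrite cLnormZ// lte_mul_pinfty// lee_fin normc_ge0.
Qed.

HB.instance Definition _ := GRing.isSubmodClosed.Build _ _ (cLfun p1)
  cLfun_submod_closed.

Record cLfunType := CLfun { cLfun_val :> T -> R[i]; cLfunP : cLfun_val \in cLfun p1 }.
HB.instance Definition _ := [isSub for cLfun_val].
HB.instance Definition _ := [Choice of cLfunType by <:].
HB.instance Definition _ := [SubChoice_isSubLmodule of cLfunType by <:].

Definition null_fun of 1 <= p : {pred cLfunType} :=
  fun u => `[< (u : T -> R[i]) = cst 0 %[ae mu] >].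

Lemma null_fun_zmod_closed : zmod_closed (null_fun p1).
Proof.
split; first by apply/asboolP/aeW.
move=> u v /asboolP u0 /asboolP v0; apply/asboolP; near=> t.
move=> _; rewrite -[LHS]/(u t - v t) (near u0 t)// (near v0 t)//.
exact: subrr.
Unshelve. all: by end_near. Qed.

HB.instance Definition _ := GRing.isZmodClosed.Build _ (null_fun p1)
  null_fun_zmod_closed.

Local Open Scope quotient_scope.
Definition Lp : Type := Quotient.quot (null_fun p1).
HB.instance Definition _ := Choice.on Lp.
HB.instance Definition _ := GRing.Zmodule.on Lp.

Implicit Types u v w : cLfunType.

Definition Lp_class (u : cLfunType) : Lp := \pi_(Quotient.quot (null_fun p1)) u.
Definition Lp_repr (x : Lp) : cLfunType := repr x.


Lemma Lp_reprK : cancel Lp_repr Lp_class.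
Proof. exact: reprK. Qed.

Lemma Lp_classP u v : Lp_class u = Lp_class v <-> u = v %[ae mu].
Proof.
rewrite /Lp_class; split.
  move=> /eqP; rewrite -Quotient.idealrBE => /asboolP uv0; near=> t.
  by move=> _; apply/eqP; rewrite -subr_eq0; apply/eqP; apply: (near uv0 t).
move=> uv; apply/eqP; rewrite -Quotient.idealrBE; apply/asboolP; near=> t.
by move=> _; rewrite -[LHS]/(u t - v t) (near uv t)//; exact: subrr.
Unshelve. all: by end_near. Qed.

Lemma Lp_classD u v : Lp_class (u + v) = Lp_class u + Lp_class v.
Proof. by rewrite /Lp_class !piE. Qed.

Lemma Lp_class0 : Lp_class 0 = 0.
Proof. by apply: (addrI (Lp_class 0)); rewrite addr0 -Lp_classD addr0. Qed.

Definition Lp_scale (a : R[i]) (x : Lp) : Lp := Lp_class (a *: Lp_repr x).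

Lemma Lp_classZ a u : Lp_class (a *: u) = Lp_scale a (Lp_class u).
Proof.
apply/Lp_classP; have uE : Lp_repr (Lp_class u) = u %[ae mu].
  by apply/Lp_classP; exact: Lp_reprK.
near=> t => _; congr (a * _); apply/esym.
exact: (near uE t).
Unshelve. all: by end_near. Qed.

Lemma Lp_scaleA a b x : Lp_scale a (Lp_scale b x) = Lp_scale (a * b) x.
Proof. by rewrite -[x]Lp_reprK -!Lp_classZ scalerA. Qed.
Lemma Lp_scale1 : left_id 1 Lp_scale.
Proof. by move=> x; rewrite -[x]Lp_reprK -!Lp_classZ scale1r. Qed.
Lemma Lp_scaleDr : right_distributive Lp_scale +%R.
Proof.
by move=> a x y; rewrite -[x]Lp_reprK -[y]Lp_reprK -Lp_classD -!Lp_classZ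
  scalerDr Lp_classD.
Qed.
Lemma Lp_scaleDl x : {morph Lp_scale^~ x : a b / a + b}.
Proof.
by move=> a b; rewrite -[x]Lp_reprK -!Lp_classZ scalerDl Lp_classD.
Qed.

HB.instance Definition _ := GRing.Zmodule_isLmodule.Build R[i] Lp
  Lp_scaleA Lp_scale1 Lp_scaleDr Lp_scaleDl.

Definition Lp_norm (x : Lp) : R[i] := (fine (cLnorm p (Lp_repr x)))%:C.

Lemma cLfun_meas u : cmeasurable u.
Proof. by have /asboolP[] := cLfunP u. Qed.

Lemma cLnorm_fin u : cLnorm p u \is a fin_num.
Proof.
have /asboolP[_ uoo] := cLfunP u.
by rewrite ge0_fin_numE// Lnorm_ge0.
Qed.

Lemma cLnorm_ae u v : u = v %[ae mu] -> cLnorm p u = cLnorm p v.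
Proof.
move=> uv; rewrite /cLnorm unlock /Lnorm; congr (_ `^ _)%E.
have mpow w : measurable_fun setT (fun x => (`|(normc (w x))%:E| `^ p)%E).
  rewrite (_ : (fun _ => _) = EFin \o (fun x => `|normc (w x)| `^ p))//.
  apply/measurable_EFinP; apply: (measurableT_comp (measurable_powR _)) => //.
  apply: measurableT_comp => //; exact/measurable_normc/cLfun_meas.
apply: ae_eq_integral => //.
by near=> t => _; rewrite (near uv t).
Unshelve. all: by end_near. Qed.

Lemma Lp_norm_class u : Lp_norm (Lp_class u) = (fine (cLnorm p u))%:C.
Proof.
congr (_%:C); congr fine; apply: cLnorm_ae.
by apply/Lp_classP; exact: Lp_reprK.
Qed.

Lemma Lp_norm_triangle x y : Lp_norm (x + y) <= Lp_norm x + Lp_norm y.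
Proof.
rewrite -[x]Lp_reprK -[y]Lp_reprK; move: (Lp_repr x) (Lp_repr y) => u v.
rewrite -Lp_classD !Lp_norm_class -rmorphD lecR -lee_fin EFinD !fineK ?cLnorm_fin//.
by apply: cLnormD; exact: cLfun_meas.
Qed.

Lemma Lp_normZ a x : Lp_norm (a *: x) = `|a| * Lp_norm x.
Proof.
rewrite -[x]Lp_reprK; move: (Lp_repr x) => u.
rewrite -[_ *: _]/(Lp_scale _ _) -Lp_classZ !Lp_norm_class.
have /asboolP[mu' uoo] := cLfunP u.
have -> : cLnorm p (a *: u : cLfunType) = ((normc a)%:E * cLnorm p u)%E.
  exact: cLnormZ.
by rewrite fineM ?cLnorm_fin//= rmorphM.
Qed.

Lemma Lp_norm0_eq0 x : Lp_norm x = 0 -> x = 0.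
Proof.
rewrite -[x]Lp_reprK; move: (Lp_repr x) => u.
rewrite Lp_norm_class => /complexI u0.
rewrite -Lp_class0; apply/Lp_classP.
have mnu := measurable_normc (cLfun_meas u).
have {}u0 : cLnorm p u = 0%E by rewrite -(fineK (cLnorm_fin u)) u0.
have mnuE : measurable_fun setT (fun t => (normc (u t))%:E).
  exact/measurable_EFinP.
have := Lnorm_eq0_eq0 mnuE _ u0; rewrite lte_fin => /(_ p_gt0) {}u0.
near=> t => _; apply: Normc.eq0_normc; apply/EFin_inj.
exact: (near u0 t).
Unshelve. all: by end_near. Qed.

HB.instance Definition _ := Lmodule_isNormed.Build R[i] Lp
  Lp_norm_triangle Lp_normZ Lp_norm0_eq0.
End ComplexLp.

Section Bochner.
Context d (T : measurableType d) (R : realType).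
Variable mu : {measure set T -> \bar R}.

Definition cintegral (f : T -> R[i]) : R[i] :=
  Rintegral mu setT (fun t => Re (f t)) +i* Rintegral mu setT (fun t => Im (f t)).

(* The class of [f] in L^p(mu), and 0 when [f] is not p-integrable. *)
Definition Lp_of (p : R) (p1 : 1 <= p) (f : T -> R[i]) : Lp mu p1 :=
  Lp_class (insubd (0 : cLfunType mu p1) f).

Variable V : normedModType R[i].

(* Finite sums of indicators of measurable sets of finite measure, with values
   in V; no disjointness is required. *)
Record simple_map := SimpleMap {
  sm_size : nat;
  sm_set : 'I_sm_size -> set T;
  sm_val : 'I_sm_size -> V;
  sm_measurable : forall i, measurable (sm_set i);
  sm_finite : forall i, (mu (sm_set i) < +oo)%E }.

Definition sm_fun (s : simple_map) (t : T) : V :=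
  \sum_(i < sm_size s) (\1_(sm_set i) t : R[i]) *: sm_val i.

Definition sm_integral (s : simple_map) : V :=
  \sum_(i < sm_size s) (fine (mu (sm_set i)))%:C *: sm_val i.

(* The first condition makes [f] strongly measurable up to a null set, so that
   the integral of norms in the second one (defined for every nonnegative
   function) is the genuine one. *)
Definition is_Bochner_integral (f : T -> V) (I : V) : Prop :=
  exists s : nat -> simple_map,
  [/\ {ae mu, forall t, sm_fun (s n) t @[n --> \oo] --> f t},
      (\int[mu]_t (rnorm (f t - sm_fun (s n) t))%:E)%E @[n --> \oo] --> 0%E &
      sm_integral (s n) @[n --> \oo] --> I].

End Bochner.

Section ProjectiveTensor.
Context (R : realType).

Definition bilinear_map (X Y Z : lmodType R[i]) (b : X -> Y -> Z) : Prop :=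
  (forall x, linear (b x)) /\ (forall y, linear (b^~ y)).

Definition tensor_sum (X Y Z : lmodType R[i]) (b : X -> Y -> Z)
  (s : seq (X * Y)) : Z := \sum_(w <- s) b w.1 w.2.

(* Equality of sum x_i (x) y_i and sum x'_j (x) y'_j in the algebraic tensor
   product of X and Y, through its universal property. *)
Definition tensor_eq (X Y : lmodType R[i]) (s s' : seq (X * Y)) : Prop :=
  forall (Z : lmodType R[i]) (b : X -> Y -> Z), bilinear_map b ->
    tensor_sum b s = tensor_sum b s'.

Definition projective_norm (X Y : normedModType R[i]) (s : seq (X * Y)) : R :=
  inf [set c | exists2 s', tensor_eq s s' &
                c = \sum_(w <- s') rnorm w.1 * rnorm w.2].

(* [ten : X -> Y -> A] exhibits the Banach space A as the completion of the
   algebraic tensor product of X and Y for the projective norm. *)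
Definition is_projective_tensor (X Y : normedModType R[i])
    (A : completeNormedModType R[i]) (ten : X -> Y -> A) : Prop :=
  [/\ bilinear_map ten,
      forall s, rnorm (tensor_sum ten s) = projective_norm s &
      dense (range (tensor_sum ten))].

End ProjectiveTensor.

Section BanachAlgebra.
Context (R : realType).

(* The linear subspace D of V, with the norm N and the product mul, is a
   commutative Banach algebra.  Nothing is required of N and mul off D. *)
Record is_comm_Banach_algebra (V : lmodType R[i]) (D : set V) (N : V -> R)
    (mul : V -> V -> V) : Prop := {
  cba_0 : D 0;
  cba_lin : forall a u v, D u -> D v -> D (a *: u + v);
  cba_norm_ge0 : forall u, D u -> 0 <= N u;
  cba_norm_eq0 : forall u, D u -> N u = 0 -> u = 0;
  cba_normZ : forall a u, D u -> N (a *: u) = normc a * N u;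
  cba_normD : forall u v, D u -> D v -> N (u + v) <= N u + N v;
  cba_complete : forall u : nat -> V, (forall n, D (u n)) ->
    (forall e, 0 < e -> exists n0, forall m n, (n0 <= m)%N -> (n0 <= n)%N ->
      N (u m - u n) < e) ->
    exists2 l, D l & N (u n - l) @[n --> \oo] --> (0 : R);
  cba_mul : forall u v, D u -> D v -> D (mul u v);
  cba_mulDl : forall a u v w, D u -> D v -> D w ->
    mul (a *: u + v) w = a *: mul u w + mul v w;
  cba_mulA : forall u v w, D u -> D v -> D w -> mul u (mul v w) = mul (mul u v) w;
  cba_mulC : forall u v, D u -> D v -> mul u v = mul v u;
  cba_normM : forall u v, D u -> D v -> N (mul u v) <= N u * N v }.

Record is_isometric_algebra_iso (V W : lmodType R[i])
    (D : set V) (N : V -> R) (mul : V -> V -> V)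
    (D' : set W) (N' : W -> R) (mul' : W -> W -> W) (f : V -> W) : Prop := {
  iso_bij : set_bij D D' f;
  iso_linear : forall a u v, D u -> D v -> f (a *: u + v) = a *: f u + f v;
  iso_mul : forall u v, D u -> D v -> f (mul u v) = mul' (f u) (f v);
  iso_norm : forall u, D u -> N' (f u) = N u }.

End BanachAlgebra.

Section HaarMeasure.
Context (R : realType).

(* The Haar measure dt/|t| of the multiplicative group of nonzero reals, carried
   by R: the point 0 is null, hence functions on R modulo haar-a.e. equality are
   functions on the group modulo a.e. equality. *)
Definition haar (B : set (measurableTypeR R)) : \bar R :=
  (\int[@lebesgue_measure R]_(t in B) (`|t|^-1)%:E)%E.

Let measurable_density : measurable_fun setT (fun t : measurableTypeR R => (`|t|^-1)%:E).
Proof.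
apply/measurable_EFinP.
have -> : (fun t : measurableTypeR R => `|t|^-1) = fun t => `|t| `^ (-1).
  by apply/funext => t; rewrite powR_inv1.
apply: (measurableT_comp (measurable_powR _)) => //.
Qed.

Let haar0 : haar set0 = 0%E.
Proof. exact: integral_set0. Qed.

Let haar_ge0 B : (0 <= haar B)%E.
Proof. by apply: integral_ge0 => t _; rewrite lee_fin invr_ge0. Qed.

Let haar_sigma_additive : semi_sigma_additive haar.
Proof.
move=> /= F mF tF mUF; rewrite /haar.
apply: (semi_sigma_additive_nng_induced measurable_density _ mF tF mUF) => t.
by rewrite lee_fin invr_ge0.
Qed.

HB.instance Definition _ := isMeasure.Build _ _ _ haar
  haar0 haar_ge0 haar_sigma_additive.

End HaarMeasure.

Section Affine.
Context (R : realType).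

Definition Rx : Type := set_type [set t : R | t != 0].
HB.instance Definition _ := Choice.on Rx.
HB.instance Definition _ := Topological.on Rx.

Definition affine : Type := (R * Rx)%type.
HB.instance Definition _ := Choice.on affine.
HB.instance Definition _ := Topological.on affine.

Definition dil (g : affine) : R := set_val g.2.

Lemma dil_neq0 g : dil g != 0.
Proof. exact: (set_valP g.2). Qed.

Definition mk_affine (b a : R) (a0 : a != 0) : affine :=
  (b, exist _ a (mem_set a0)).

Let mulf_neq0' g h : dil g * dil h != 0.
Proof. by rewrite mulf_neq0 ?dil_neq0. Qed.
Let invf_neq0' g : (dil g)^-1 != 0.
Proof. by rewrite invr_neq0 ?dil_neq0. Qed.

(* (b, a) (b', a') = (a b' + b, a a') *)
Definition affine_mul (g h : affine) : affine :=
  mk_affine (dil g * h.1 + g.1) (mulf_neq0' g h).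
Definition affine_one : affine := mk_affine 0 (oner_neq0 R).
Definition affine_inv (g : affine) : affine :=
  mk_affine (- (dil g)^-1 * g.1) (invf_neq0' g).

Lemma affine_eq (g h : affine) : g.1 = h.1 -> dil g = dil h -> g = h.
Proof.
case: g h => [b a] [b' a'] /= -> aa'; congr (_, _).
exact: val_inj.
Qed.

Lemma affine_mulA : associative affine_mul.
Proof.
move=> g h k; apply: affine_eq => /=; last exact: mulrA.
by rewrite mulrDr mulrA addrA.
Qed.

Lemma affine_mul1g : left_id affine_one affine_mul.
Proof.
move=> g; apply: affine_eq => /=; last exact: mul1r.
by rewrite addr0; exact: mul1r.
Qed.

Lemma affine_mulg1 : right_id affine_one affine_mul.
Proof.
move=> g; apply: affine_eq => /=; last exact: mulr1.
by rewrite mulr0 add0r.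
Qed.

Lemma affine_mulVg : left_inverse affine_one affine_inv affine_mul.
Proof.
move=> g; apply: affine_eq => /=; first by rewrite mulNr subrr.
exact: mulVf (dil_neq0 g).
Qed.

Lemma affine_mulgV : right_inverse affine_one affine_inv affine_mul.
Proof.
move=> g; apply: affine_eq => /=; last exact: mulfV (dil_neq0 g).
by rewrite mulNr mulrN mulrA mulfV ?dil_neq0// mul1r addNr.
Qed.

HB.instance Definition _ := isGroup.Build affine
  affine_mulA affine_mul1g affine_mulg1 affine_mulVg affine_mulgV.

End Affine.

Section DualConvolution.
Context (R : realType).

Definition C0 (X : topologicalType) : set (X -> R[i]) := [set f |
  continuous (f : X -> R[i]^o) /\
  forall e : R, 0 < e ->
    exists2 K : set X, compact K & forall x, ~ K x -> normc (f x) < e].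

Definition cis (x : R) : R[i] := cos x +i* sin x.

Definition LpRx (p : R) (p1 : 1 <= p) := Lp (@haar R) p1.

(* Only used for r != 0, up to a null set of parameters. *)
Definition lambda (r : R) (f : R -> R[i]) : R -> R[i] := fun t => f (r^-1 * t).

Variables (p q : R) (p1 : 1 <= p) (q1 : 1 <= q).
Variables (A : completeNormedModType R[i]) (ten : LpRx p1 -> LpRx q1 -> A).

Definition twist (h : R) (f f' : R -> R[i]) : R -> R[i] :=
  fun t => lambda (1 + h) f t * lambda (1 + h^-1) f' t.

(* The chosen representatives [Lp_repr] are immaterial: for h outside the null
   set {0, -1}, replacing them changes [twist] on a null set only.  The twisted
   products are p- and q-integrable for almost every h. *)
Definition is_boxtimes (box : A -> A -> A) : Prop :=
  [/\ bilinear_map box,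
      forall u v, rnorm (box u v) <= rnorm u * rnorm v &
      forall (xi xi' : LpRx p1) (eta eta' : LpRx q1),
        is_Bochner_integral (@haar R)
          (fun h => ten (Lp_of (@haar R) p1 (twist h (Lp_repr xi) (Lp_repr xi')))
                        (Lp_of (@haar R) q1 (twist h (Lp_repr eta) (Lp_repr eta'))))
          (box (ten xi eta) (ten xi' eta'))].

Definition is_Psi (Psi : A -> (affine R -> R[i])) : Prop :=
  [/\ linear Psi,
      forall u g, normc (Psi u g) <= rnorm u,
      forall u, C0 (Psi u) &
      forall (xi : LpRx p1) (eta : LpRx q1) (g : affine R),
        Psi (ten xi eta) g =
        cintegral (@haar R) (fun t =>
          cis (2 * pi * g.1 * t) * Lp_repr xi (t * dil g) * Lp_repr eta t)].

(* The quotient norm of A / ker Psi transported to the range of Psi: the fibre of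
   [f = Psi u] is the coset u + ker Psi. *)
Definition quotient_norm (Psi : A -> (affine R -> R[i])) (f : affine R -> R[i]) : R :=
  inf [set rnorm u | u in [set u | Psi u = f]].

Definition ptwise_mul (f g : affine R -> R[i]) : affine R -> R[i] :=
  fun x => f x * g x.

End DualConvolution.

(* Main.v *)
Require Import Defs.
From HB Require Import structures.
From mathcomp Require Import all_boot all_order all_algebra.
From mathcomp Require Import all_classical all_reals all_analysis measurable_realfun.
From mathcomp Require Import complex.
From mathcomp Require Import ring lra.
Set Implicit Arguments.
Unset Strict Implicit.
Unset Printing Implicit Defensive.
Import Order.TTheory GRing.Theory Num.Theory numFieldNormedType.Exports.
Local Open Scope classical_set_scope.
Local Open Scope ring_scope.
Local Open Scope complex_scope.

Local Notation Re := (@complex.Re _).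
Local Notation Im := (@complex.Im _).
Local Notation normc := (@Normc.normc _).
Import Defs.

(** Write mu for the Haar measure dt/|t| and A for the projective tensor product
    of L^p(mu) and L^q(mu). Everything follows from two facts: Psi is
    multiplicative ([Psi_box]) and Psi is injective ([Psi_injective]).
    Associativity and commutativity of the product of A are then inherited from
    the pointwise product of functions, the fibres of Psi are points, so that the
    quotient norm of Psi u is the norm of u, and the Banach algebra structure of
    A is transported to the range of Psi ([Banach_algebra_transport]).

    Multiplicativity. By continuity it suffices to treat elementary tensors
    ([functional_eq0]). Evaluation of Psi at a point is a contractive functional,
    hence commutes with the Bochner integral that defines the product
    ([Bochner_functional]). On the other side, the product of two coefficient
    integrals over s and s' becomes, with s' = h s, an iterated integral over h
    and s ([cintegral_mconv], a form of Fubini's theorem for the Haar measure),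
    and the dilation s = t / (1 + h) turns the inner integral into the
    coefficient of the twisted product with parameter h
    ([Psi_box_elementary]).

    Injectivity. Let Psi u = 0, and think of u as a kernel K(s, t), the sum of
    xi_n(s) eta_n(t) for u the sum of xi_n (x) eta_n. For fixed a the function
    t |-> K(t a, t) has vanishing Fourier transform with respect to mu, so it is
    zero: its integrals over all Borel sets vanish ([vanishing_indic]). Fourier
    uniqueness is proved here by a monotone class argument: weights for which the
    integral vanishes are stable under modulation, linear combination and bounded
    limits, and square waves of decreasing frequency lead from trigonometric
    polynomials to half-lines ([trigonometric_class]). Averaging over a shows that
    the integrals of K over bounded rectangles I x J are zero
    ([vanishing_product]). A nonzero element of a projective tensor product can
    have a vanishing kernel in general; L^p excludes this because it has the
    approximation property, which enters through conditional expectations P onto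
    finite families of disjoint sets. They are contractions of finite rank
    ([cond_exp_contraction]), P (x) P kills u because its matrix entries are
    integrals of K over rectangles ([vanishing_cond_exp]), and u is close to a
    finite sum of tensors of simple functions, which P (x) P fixes for a suitable
    P ([Psi_kernel]).

    A functional of u stands for the extension by continuity of a bounded
    bilinear map from finite sums of elementary tensors. Only the vanishing of
    such extensions at u matters, and [vanishes_at] expresses it as an estimate on
    finite sums that is stable under the limits above. *)

(** * Complex-valued integrals *)

Lemma squeeze_cvg0 (R : realType) (u v : nat -> R) :
  (forall n, 0 <= u n <= v n) -> v n @[n --> \oo] --> (0 : R) ->
  u n @[n --> \oo] --> (0 : R).
Proof.
move=> uv v0; apply: (@squeeze_cvgr _ _ _ _ (fun=> 0) v) => //; last exact: cvg_cst.
exact: nearW.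
Qed.

Section ComplexNumbers.
Context (R : realType).
Implicit Types z w : R[i].

Lemma complexE z : z = (Re z)%:C + 'i%C * (Im z)%:C.
Proof. by case: z => a b; apply/eqP; rewrite eq_complex/=; apply/andP; split; apply/eqP; ring. Qed.

Lemma normcD z w : normc (z + w) <= normc z + normc w.
Proof. exact: le_normcD. Qed.

Lemma normc_opp z : normc (- z) = normc z.
Proof. exact: complex.normcN. Qed.

Lemma normcB z w : normc (z - w) <= normc z + normc w.
Proof. by rewrite -(normc_opp w) normcD. Qed.

Lemma normc_real (x : R) : normc x%:C = `|x|.
Proof. by rewrite /= expr0n/= addr0 sqrtr_sqr. Qed.

Lemma normRe_le z : `|Re z| <= normc z.
Proof.
case: z => a b /=; rewrite -sqrtr_sqr ler_wsqrtr// lerDl; exact: sqr_ge0.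
Qed.

Lemma normIm_le z : `|Im z| <= normc z.
Proof.
case: z => a b /=; rewrite -sqrtr_sqr ler_wsqrtr// lerDr; exact: sqr_ge0.
Qed.

Lemma sqr_normc z : normc z ^+ 2 = Re (z^* * z).
Proof. by case: z => a b /=; rewrite sqr_sqrtr ?addr_ge0 ?sqr_ge0//; ring. Qed.

Lemma normc_conj z : normc (z^*) = normc z.
Proof. by case: z => a b /=; rewrite sqrrN. Qed.

Lemma ReB z w : Re (z - w) = Re z - Re w.
Proof. by case: z; case: w. Qed.
Lemma ImB z w : Im (z - w) = Im z - Im w.
Proof. by case: z; case: w. Qed.

Lemma normc_cis (x : R) : normc (cis x) = 1.
Proof. by rewrite /= cos2Dsin2 sqrtr1. Qed.

Lemma cisD (x y : R) : cis (x + y) = cis x * cis y.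
Proof.
by apply/eqP; rewrite eq_complex/= cosD sinD addrC; apply/andP; split; apply/eqP; ring.
Qed.

Lemma cis0 : cis 0 = 1 :> R[i].
Proof. by rewrite /cis cos0 sin0. Qed.

End ComplexNumbers.

Section ComplexIntegral.
Context d (T : measurableType d) (R : realType).
Variable mu : {measure set T -> \bar R}.
Implicit Types f g : T -> R[i].

Lemma ae_imply (P Q : T -> Prop) : (forall t, P t -> Q t) ->
  {ae mu, forall t, P t} -> {ae mu, forall t, Q t}.
Proof. by move=> PQ; apply: filterS. Qed.

Lemma cmeasurable_cst (a : R[i]) : cmeasurable (fun _ : T => a).
Proof. by split; exact: measurable_cst. Qed.

Lemma cmeasurableM f g : cmeasurable f -> cmeasurable g ->
  cmeasurable (fun t => f t * g t).
Proof.
move=> [fr fi] [gr gi]; split.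
  under eq_fun do rewrite ReM.
  by apply: measurable_funB; exact: measurable_funM.
under eq_fun do rewrite ImM.
by apply: measurable_funD; exact: measurable_funM.
Qed.

Lemma cmeasurableB f g : cmeasurable f -> cmeasurable g ->
  cmeasurable (fun t => f t - g t).
Proof.
move=> [fr fi] [gr gi]; split.
  by under eq_fun do rewrite ReB; exact: measurable_funB.
by under eq_fun do rewrite ImB; exact: measurable_funB.
Qed.

Lemma cmeasurable_comp d' (T' : measurableType d') (h : T' -> T) f :
  measurable_fun setT h -> cmeasurable f -> cmeasurable (f \o h).
Proof.
move=> mh [fr fi]; split; first exact: (measurableT_comp fr mh).
exact: (measurableT_comp fi mh).
Qed.

Lemma cmeasurable_real (h : T -> R) :
  measurable_fun setT h -> cmeasurable (fun t => (h t)%:C).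
Proof. by move=> mh; split => //=; exact: measurable_cst. Qed.

Lemma cmeasurable_indic (B : set T) :
  measurable B -> cmeasurable (fun t => (\1_B t : R[i])).
Proof.
move=> mB; have -> : (fun t => (\1_B t : R[i])) = fun t => ((\1_B t : R))%:C.
  by apply/funext => t; rewrite !indicE; case: (t \in B).
by apply: cmeasurable_real; exact: measurable_indic.
Qed.

Lemma cmeasurable_cvg (f_ : nat -> T -> R[i]) f :
  (forall n, cmeasurable (f_ n)) ->
  (forall t, normc (f_ n t - f t) @[n --> \oo] --> (0 : R)) -> cmeasurable f.
Proof.
move=> mf cf; split.
- apply: (@measurable_fun_cvg _ _ _ _ (fun n t => Re (f_ n t))) => // [n|t _].
    by case: (mf n).
  apply/subr_cvg0/norm_cvg0P.
  apply: squeeze_cvg0 (cf t) => n.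
  by rewrite normr_ge0/= -ReB; exact: normRe_le.
- apply: (@measurable_fun_cvg _ _ _ _ (fun n t => Im (f_ n t))) => // [n|t _].
    by case: (mf n).
  apply/subr_cvg0/norm_cvg0P.
  apply: squeeze_cvg0 (cf t) => n.
  by rewrite normr_ge0/= -ImB; exact: normIm_le.
Qed.

Definition cintegrable f :=
  cmeasurable f /\ (\int[mu]_t (normc (f t))%:E < +oo)%E.

Lemma cintegrable_norm f : cintegrable f ->
  mu.-integrable setT (fun t => (normc (f t))%:E).
Proof.
move=> [mf foo]; apply/integrableP; split.
  exact/measurable_EFinP/measurable_normc.
by under eq_integral do rewrite gee0_abs ?lee_fin ?normc_ge0//.
Qed.

Lemma cintegrable_le f (g : T -> R) : cmeasurable f ->
  mu.-integrable setT (EFin \o g) -> (forall t, normc (f t) <= g t) ->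
  cintegrable f.
Proof.
move=> mf /integrableP[mg goo] fg; split => //; apply: le_lt_trans goo.
apply: ge0_le_integral => //.
- by move=> t _; rewrite lee_fin normc_ge0.
- exact/measurable_EFinP/measurable_normc.
- exact: measurableT_comp.
- by move=> t _; rewrite lee_fin (le_trans (fg t))// ler_norm.
Qed.

Lemma cintegrable_Re f : cintegrable f -> mu.-integrable setT (EFin \o (fun t => Re (f t))).
Proof.
move=> cf; apply: le_integrable (cintegrable_norm cf) => //.
  by case: cf => -[mf _] _; exact/measurable_EFinP.
by move=> t _ /=; rewrite lee_fin (ger0_norm (normc_ge0 _)) normRe_le.
Qed.

Lemma cintegrable_Im f : cintegrable f -> mu.-integrable setT (EFin \o (fun t => Im (f t))).
Proof.
move=> cf; apply: le_integrable (cintegrable_norm cf) => //.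
  by case: cf => -[_ mf] _; exact/measurable_EFinP.
by move=> t _ /=; rewrite lee_fin (ger0_norm (normc_ge0 _)) normIm_le.
Qed.

Lemma cintegrableD f g : cintegrable f -> cintegrable g ->
  cintegrable (fun t => f t + g t).
Proof.
move=> cf cg; apply: (@cintegrable_le _ (fun t => normc (f t) + normc (g t))).
- by apply: cmeasurableD; [case: cf|case: cg].
- exact: (integrableD _ (cintegrable_norm cf) (cintegrable_norm cg)).
- by move=> t; exact: normcD.
Qed.

Lemma cintegrableMb (M : R) f g : cintegrable f -> cmeasurable g ->
  (forall t, normc (g t) <= M) -> cintegrable (fun t => g t * f t).
Proof.
move=> cf mg gM; apply: (@cintegrable_le _ (fun t => M * normc (f t))).
- by apply: cmeasurableM => //; case: cf.
- have := integrableZl measurableT M (cintegrable_norm cf).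
  by apply: eq_integrable => // t _; rewrite /= EFinM.
- by move=> t; rewrite Normc.normcM ler_wpM2r// normc_ge0.
Qed.

Lemma cintegrableZ a f : cintegrable f -> cintegrable (fun t => a * f t).
Proof.
by move=> cf; apply: (@cintegrableMb (normc a) f (fun=> a)) => //; exact: cmeasurable_cst.
Qed.

Lemma cintegrableB f g : cintegrable f -> cintegrable g ->
  cintegrable (fun t => f t - g t).
Proof.
move=> cf cg; have := cintegrableD cf (cintegrableZ (-1) cg).
by under eq_fun do rewrite mulN1r.
Qed.

Lemma cintegralD f g : cintegrable f -> cintegrable g ->
  cintegral mu (fun t => f t + g t) = cintegral mu f + cintegral mu g.
Proof.
move=> cf cg; rewrite /cintegral; apply/eqP; rewrite eq_complex/=; apply/andP; split; apply/eqP.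
  under eq_Rintegral do rewrite ReD.
  by rewrite RintegralD//; exact: cintegrable_Re.
under eq_Rintegral do rewrite ImD.
by rewrite RintegralD//; exact: cintegrable_Im.
Qed.

Lemma cintegralZ a f : cintegrable f ->
  cintegral mu (fun t => a * f t) = a * cintegral mu f.
Proof.
move=> cf.
have iR r : mu.-integrable setT (EFin \o (fun t => r * Re (f t))).
  have := integrableZl measurableT r (cintegrable_Re cf).
  by apply: eq_integrable => // t _; rewrite /= EFinM.
have iI r : mu.-integrable setT (EFin \o (fun t => r * Im (f t))).
  have := integrableZl measurableT r (cintegrable_Im cf).
  by apply: eq_integrable => // t _; rewrite /= EFinM.
rewrite /cintegral; apply/eqP; rewrite eq_complex ReM ImM/=; apply/andP; split; apply/eqP.
  under eq_Rintegral do rewrite ReM.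
  by rewrite RintegralB// !RintegralZl//; [exact: cintegrable_Im|exact: cintegrable_Re].
under eq_Rintegral do rewrite ImM.
by rewrite RintegralD// !RintegralZl//; [exact: cintegrable_Re|exact: cintegrable_Im].
Qed.

Lemma cintegralB f g : cintegrable f -> cintegrable g ->
  cintegral mu (fun t => f t - g t) = cintegral mu f - cintegral mu g.
Proof.
move=> cf cg; have := cintegralD cf (cintegrableZ (-1) cg).
rewrite cintegralZ// mulN1r => <-; congr cintegral; apply/funext => t.
by rewrite mulN1r.
Qed.

Lemma cintegral0 : cintegral mu (fun=> 0) = 0.
Proof. by rewrite /cintegral /Rintegral integral0. Qed.

Lemma eq_cintegral f g : f =1 g -> cintegral mu f = cintegral mu g.
Proof. by move=> fg; congr cintegral; exact/funext. Qed.

Lemma cintegral_sum I (s : seq I) (F : I -> T -> R[i]) :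
  (forall i, cintegrable (F i)) ->
  cintegrable (fun t => \sum_(i <- s) F i t) /\
  cintegral mu (fun t => \sum_(i <- s) F i t) = \sum_(i <- s) cintegral mu (F i).
Proof.
move=> cF; elim: s => [|i s [ih1 ih2]].
  rewrite big_nil; under eq_fun do rewrite big_nil; rewrite cintegral0; split => //.
  split; first exact: cmeasurable_cst.
  under eq_integral do rewrite Normc.normc0.
  by rewrite integral0.
rewrite big_cons; under eq_fun do rewrite big_cons.
by split; [exact: cintegrableD|rewrite cintegralD// ih2].
Qed.

(** Rotating the integral onto the positive real axis reduces the triangle
    inequality for complex integrals to the monotonicity of the real one. *)
Lemma normc_cintegral f : cintegrable f ->
  normc (cintegral mu f) <= Rintegral mu setT (fun t => normc (f t)).
Proof.
move=> cf; set z := cintegral mu f; set I := Rintegral _ _ _.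
have [z0|z0] := eqVneq (normc z) 0; first by rewrite z0 Rintegral_ge0// => t _; exact: normc_ge0.
have zgt0 : 0 < normc z by rewrite lt_neqAle eq_sym z0 normc_ge0.
rewrite -(ler_pM2l zgt0) -expr2 sqr_normc -[in leLHS]cintegralZ//=.
rewrite -RintegralZl//; last exact: cintegrable_norm.
apply: le_Rintegral => //.
- by apply: cintegrable_Re; exact: cintegrableZ.
- have := integrableZl measurableT (normc z) (cintegrable_norm cf).
  by apply: eq_integrable => // t _; rewrite /= EFinM.
- move=> t _; apply: le_trans (ler_norm _) _; apply: le_trans (normRe_le _) _.
  rewrite Normc.normcM ler_wpM2r ?normc_ge0//.
  by rewrite normc_conj.
Qed.

Lemma cintegral_ae_eq f g : cmeasurable f -> cmeasurable g ->
  f = g %[ae mu] -> cintegral mu f = cintegral mu g.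
Proof.
move=> [fr fi] [gr gi] fg; rewrite /cintegral /Rintegral.
congr (fine _ +i* fine _); apply: ae_eq_integral => //; try exact/measurable_EFinP.
  by apply: filterS fg => t h _ /=; rewrite h.
by apply: filterS fg => t h _ /=; rewrite h.
Qed.

Lemma cintegral_dominated (f_ : nat -> T -> R[i]) f (G : T -> R) :
  (forall n, cmeasurable (f_ n)) -> mu.-integrable setT (EFin \o G) ->
  (forall n t, normc (f_ n t) <= G t) ->
  (forall t, normc (f_ n t - f t) @[n --> \oo] --> (0 : R)) ->
  cintegrable f /\
  normc (cintegral mu (f_ n) - cintegral mu f) @[n --> \oo] --> (0 : R).
Proof.
move=> mf iG fG cf.
have mf' : cmeasurable f by apply: cmeasurable_cvg cf.
have fG' t : normc (f t) <= G t.
  apply/ler_addgt0Pl => e e0.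
  have /cvgrPdist_lt/(_ _ e0)[n _ /(_ n (leqnn n))] := cf t.
  rewrite sub0r normrN ger0_norm ?normc_ge0// => h.
  rewrite -[f t](subKr (f_ n t)) (le_trans (normcB _ _))// addrC lerD//.
  exact: ltW.
have cif : cintegrable f by apply: cintegrable_le iG fG'.
have cifn n : cintegrable (f_ n) by apply: cintegrable_le iG (fG n).
split => //.
have [] := @dominated_convergence _ _ _ mu setT measurableT
  (fun n t => (normc (f_ n t - f t))%:E) (cst 0%E) (fun t => (2 * G t)%:E).
- by move=> n; apply/measurable_EFinP/measurable_normc; exact: cmeasurableB.
- exact: measurable_cst.
- apply: aeW => t _; apply: cvg_EFin; first exact: nearW.
  exact: cf.
- have := integrableZl measurableT 2 iG.
  by apply: eq_integrable => // t _; rewrite /= EFinM.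
- apply: aeW => t n _; rewrite /= lee_fin ger0_norm ?normc_ge0//.
  by rewrite (le_trans (normcB _ _))// mulr_natl mulr2n lerD.
move=> _ _; rewrite integral0 => /fine_cvg h.
apply: squeeze_cvg0 h => n; rewrite normc_ge0 -cintegralB//.
by apply: normc_cintegral; exact: cintegrableB.
Qed.

Lemma cLnormE (p : R) f :
  cLnorm mu p f = ((\int[mu]_t ((normc (f t)) `^ p)%:E) `^ p^-1)%E.
Proof.
rewrite /cLnorm unlock; under eq_integral => t _.
  rewrite /= ger0_norm ?normc_ge0//; over.
by [].
Qed.

End ComplexIntegral.
(** * The Haar measure of the multiplicative group *)

Section Scaling.
Context (R : realType).
Local Notation TR := (measurableTypeR R).
Local Notation leb := (@lebesgue_measure R).

Lemma measurable_mulr (a : R) : measurable_fun [set: TR] (fun t : TR => (t * a : TR)).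
Proof. by apply: measurable_funM => //; exact: measurable_cst. Qed.

Lemma measurable_abs_inv : measurable_fun [set: TR] (fun t : TR => `|t|^-1).
Proof.
have -> : (fun t : TR => `|t|^-1) = fun t => `|t| `^ (-1).
  by apply/funext => t; rewrite powR_inv1.
apply: (measurableT_comp (measurable_powR _)) => //.
Qed.

Lemma lebesgue_measure_scale (a : R) (B : set TR) : a != 0 -> measurable B ->
  leb ((fun t => (t * a)%R) @^-1` B) = (`|a|^-1%:E * leb B)%E.
Proof.
move=> a0 mB.
have na0 : 0 < `|a| by rewrite normr_gt0.
suff -> : leb B = (`|a|%:E * leb ((fun t => (t * a)%R) @^-1` B))%E.
  by rewrite muleA -EFinM mulVf ?gt_eqF// mul1e.
pose phi : TR -> TR := fun t => t * a.
have mphi : measurable_fun [set: TR] phi := measurable_mulr a.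
pose m : {measure set TR -> \bar R} := mscale (NngNum (normr_ge0 a))
  (measure_function_pushforward__canonical__measure_function_Measure leb mphi).
rewrite -[RHS]/(m B).
apply: lebesgue_measure_unique => //= _ [[x y]] _ <-.
rewrite /m /mscale/= /pushforward/= /phi.
have [ap|an] := ltP 0 a.
  have -> : (fun t => t * a) @^-1` `]x, y]%classic = `]x / a, y / a]%classic.
    by apply/seteqP; split => t; rewrite /= !in_itv/= ltr_pdivrMr// ler_pdivlMr.
  rewrite !lebesgue_measure_itv/= !lte_fin ltr_pM2r ?invr_gt0//.
  case: ifPn => _; last by rewrite mule0.
  by rewrite -!EFinB -EFinM gtr0_norm// mulrBr !(mulrC a) !divfK.
have {}an : a < 0 by rewrite lt_neqAle a0.
have -> : (fun t => t * a) @^-1` `]x, y]%classic = `[y / a, x / a[%classic.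
  by apply/seteqP; split => t; rewrite /= !in_itv/= ltr_ndivlMr// ler_ndivrMr// andbC.
rewrite !lebesgue_measure_itv/= !lte_fin ltr_nM2r ?invr_lt0//.
case: ifPn => _; last by rewrite mule0.
by rewrite -!EFinB -EFinM ltr0_norm// mulrBr !mulNr !(mulrC a) !divfK// opprK addrC.
Qed.

Lemma ge0_integral_lebesgue_scale (a : R) (f : TR -> \bar R) : a != 0 ->
  measurable_fun setT f -> (forall t, (0 <= f t)%E) ->
  (\int[leb]_t f (t * a)%R = `|a|^-1%:E * \int[leb]_t f t)%E.
Proof.
move=> a0 mf f0.
pose phi : TR -> TR := fun t => t * a.
have mphi : measurable_fun [set: TR] phi := measurable_mulr a.
have := @ge0_integral_pushforward _ _ TR TR R phi mphi leb setT f measurableT mf (fun y _ => f0 y).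
rewrite preimage_setT => <-.
have ia0 : 0 <= `|a|^-1 by rewrite invr_ge0.
rewrite -[X in (X%:E * _)%E]/((NngNum ia0)%:num) -ge0_integral_mscale//.
by apply: eq_measure_integral => //= B mB _; exact: lebesgue_measure_scale.
Qed.

End Scaling.

Section Haar.
Context (R : realType).
Local Notation TR := (measurableTypeR R).
Local Notation leb := (@lebesgue_measure R).
Local Notation mu := (@haar R).

Lemma haar_scale (a : R) (B : set TR) : a != 0 -> measurable B ->
  mu ((fun t => t * a) @^-1` B) = mu B.
Proof.
move=> a0 mB; rewrite /haar integral_mkcond [RHS]integral_mkcond.
have na0 : `|a| != 0 by rewrite normr_eq0.
pose g : TR -> \bar R := ((fun t : TR => (`|t|^-1)%:E) \_ B)%E.
have mg : measurable_fun setT g.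
  apply/(measurable_restrictT _ mB); apply/measurable_EFinP.
  by apply: measurable_funTS; exact: measurable_abs_inv.
have g0 t : (0 <= g t)%E.
  by rewrite /g patchE; case: ifP => // _; rewrite lee_fin invr_ge0.
rewrite [LHS](_ : _ = \int[leb]_t ((fun t => `|a|%:E * g t) (t * a)%R))%E; last first.
  apply: eq_integral => t _; rewrite /g !patchE.
  rewrite (_ : (t \in (fun t => t * a) @^-1` B) = (t * a \in B))//.
  case: ifP => _; last by rewrite mule0.
  by rewrite -EFinM normrM invfM mulrCA mulfV// mulr1.
rewrite (@ge0_integral_lebesgue_scale R a (fun t => `|a|%:E * g t)%E)//; last 2 first.
- exact: measurable_funeM.
- by move=> t; rewrite mule_ge0.
rewrite ge0_integralZl//.
by rewrite muleA -EFinM mulVf// mul1e.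
Qed.

Lemma haar_null0 : mu [set 0] = 0%E.
Proof. by rewrite /haar integral_set1. Qed.

Lemma ae_neq0 : {ae mu, forall t, t != 0}.
Proof.
exists [set 0]; split => //; first exact: haar_null0.
by move=> t /= /negP; rewrite negbK => /eqP.
Qed.

(** The symmetric annuli, which exhaust the line and on which the density is
    bounded; the point 0 belongs to all of them because its inverse is 0. *)
Definition annulus (n : nat) : set TR := [set t | `|t| <= n.+1%:R /\ `|t|^-1 <= n.+1%:R].

Lemma measurable_annulus n : measurable (annulus n).
Proof.
have -> : annulus n = (fun t : TR => `|t|) @^-1` `]-oo, n.+1%:R]%classic `&`
    (fun t : TR => `|t|^-1) @^-1` `]-oo, n.+1%:R]%classic.
  by apply/seteqP; split => t /=; rewrite !in_itv/=.
apply: measurableI; rewrite -[X in measurable X]setTI.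
  by apply: (@normr_measurable R setT) => //; exact: measurable_itv.
by apply: measurable_abs_inv => //; exact: measurable_itv.
Qed.

Lemma haar_annulus n : (mu (annulus n) < +oo)%E.
Proof.
have mA := measurable_annulus n.
apply: (@le_lt_trans _ _ (\int[leb]_(t in annulus n) n.+1%:R%:E)%E).
  apply: ge0_le_integral => //.
  - by apply/measurable_EFinP; apply: measurable_funTS; exact: measurable_abs_inv.
  - by move=> t [_ ?]; rewrite lee_fin.
rewrite integral_cst// lte_mul_pinfty//.
apply: (@le_lt_trans _ _ (leb `[- n.+1%:R, n.+1%:R]%classic)).
  apply: le_measure; rewrite ?inE//.
  by move=> t [tn _] /=; rewrite in_itv/= -ler_norml.
by rewrite lebesgue_measure_itv/=; case: ifP => _; rewrite ?ltry// -EFinB ltry.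
Qed.

Lemma bigcup_annulus : \bigcup_n annulus n = setT.
Proof.
apply/seteqP; split => // t _.
have /archi_boundP := normr_ge0 t; set k := Num.bound _ => kt.
have it : 0 <= `|t|^-1 by rewrite invr_ge0.
have /archi_boundP := it; set l := Num.bound _ => lt.
exists (k + l)%N => //; split.
  by rewrite (le_trans (ltW kt))// ler_nat leqW// leq_addr.
by rewrite (le_trans (ltW lt))// ler_nat leqW// leq_addl.
Qed.

Lemma nondecreasing_annulus : {homo annulus : n m / (n <= m)%N >-> n `<=` m}.
Proof.
move=> n m nm t [h1 h2]; split.
  by rewrite (le_trans h1)// ler_nat ltnS.
by rewrite (le_trans h2)// ler_nat ltnS.
Qed.

Lemma sub_annulus_fin n (B : set TR) : measurable B -> B `<=` annulus n -> (mu B < +oo)%E.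
Proof.
move=> mB Bn; apply: le_lt_trans (haar_annulus n).
by apply: le_measure => //; rewrite inE//; exact: measurable_annulus.
Qed.

Lemma annulus_ratio n (h t : R) : t != 0 ->
  annulus n t -> annulus n (h * t) -> annulus (n.+1 * n.+1) h.
Proof.
move=> t0 [t1 t2] [ht1 ht2].
have sq : n.+1%:R * n.+1%:R <= (n.+1 * n.+1).+1%:R :> R by rewrite -natrM ler_nat.
have nt0 : `|t| != 0 by rewrite normr_eq0.
split; apply: le_trans sq.
  have -> : `|h| = `|h * t| * `|t|^-1 by rewrite normrM mulfK.
  by rewrite ler_pM// invr_ge0.
have -> : `|h|^-1 = `|h * t|^-1 * `|t| by rewrite normrM invfM mulfVK.
by rewrite ler_pM// invr_ge0.
Qed.

Lemma haar_sigma_finite : sigma_finite setT mu.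
Proof.
exists annulus; first by rewrite bigcup_annulus.
by move=> n; split; [exact: measurable_annulus|exact: haar_annulus].
Qed.

HB.instance Definition _ := @Measure_isSigmaFinite.Build _ TR R mu haar_sigma_finite.

Lemma ae_scale (a : R) (P : R -> Prop) : a != 0 ->
  {ae mu, forall t, P t} -> {ae mu, forall t, P (t * a)}.
Proof.
move=> a0 [N [mN N0 PN]]; exists ((fun t => t * a) @^-1` N); split.
- by rewrite -[X in measurable X]setTI; exact: measurable_mulr.
- by rewrite haar_scale.
- by move=> t /= nP; exact: PN.
Qed.

Lemma ge0_integral_haar_scale (a : R) (f : TR -> \bar R) : a != 0 ->
  measurable_fun setT f -> (forall t, (0 <= f t)%E) ->
  (\int[mu]_t f (t * a)%R = \int[mu]_t f t)%E.
Proof.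
move=> a0 mf f0.
pose phi : TR -> TR := fun t => t * a.
have mphi : measurable_fun [set: TR] phi := measurable_mulr a.
have := @ge0_integral_pushforward _ _ TR TR R phi mphi mu setT f measurableT mf (fun y _ => f0 y).
rewrite preimage_setT => <-.
by apply: eq_measure_integral => //= B mB _; exact: haar_scale.
Qed.

Lemma integral_haar_scale (a : R) (f : TR -> \bar R) : a != 0 ->
  measurable_fun setT f -> (\int[mu]_t f (t * a)%R = \int[mu]_t f t)%E.
Proof.
move=> a0 mf; rewrite integralE [RHS]integralE; congr (_ - _)%E.
  rewrite -[RHS](ge0_integral_haar_scale a0 (measurable_funepos mf))//.
  by apply: eq_integral => t _; rewrite !funeposE.
rewrite -[in RHS](ge0_integral_haar_scale a0 (measurable_funeneg mf))//.
by apply: eq_integral => t _; rewrite !funenegE.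
Qed.

Lemma cintegral_haar_scale (a : R) (f : TR -> R[i]) : a != 0 -> cmeasurable f ->
  cintegral mu (fun t => f (t * a)) = cintegral mu f.
Proof.
move=> a0 [mr mi]; rewrite /cintegral /Rintegral; congr (fine _ +i* fine _).
  by rewrite (integral_haar_scale (f := fun t => (Re (f t))%:E))//; exact/measurable_EFinP.
by rewrite (integral_haar_scale (f := fun t => (Im (f t))%:E))//; exact/measurable_EFinP.
Qed.

Lemma cmeasurable_scale (a : R) (f : TR -> R[i]) :
  cmeasurable f -> cmeasurable (fun t : TR => f (t * a)).
Proof. by move=> mf; exact: (cmeasurable_comp (measurable_mulr a) mf). Qed.

Lemma cintegrable_scale (a : R) (f : TR -> R[i]) : a != 0 ->
  cintegrable mu f -> cintegrable mu (fun t : TR => f (t * a)).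
Proof.
move=> a0 [mf foo]; split; first exact: cmeasurable_scale.
rewrite (ge0_integral_haar_scale (f := fun t => (normc (f t))%:E))//.
  exact/measurable_EFinP/measurable_normc.
by move=> t; rewrite lee_fin normc_ge0.
Qed.

Lemma cLnorm_scale (p a : R) (f : TR -> R[i]) : a != 0 -> cmeasurable f ->
  cLnorm mu p (fun t : TR => f (t * a)) = cLnorm mu p f.
Proof.
move=> a0 mf; rewrite !cLnormE.
rewrite (ge0_integral_haar_scale (f := fun t => ((normc (f t)) `^ p)%:E))//.
- apply/measurable_EFinP; apply: (measurableT_comp (measurable_powR _)) => //.
  exact/measurable_normc.
- by move=> t; rewrite lee_fin powR_ge0.
Qed.

End Haar.
(** * Fubini's theorem and multiplicative convolution *)

Section ComplexFubini.
Context d1 d2 (T1 : measurableType d1) (T2 : measurableType d2) (R : realType).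
Variable m1 : {sigma_finite_measure set T1 -> \bar R}.
Variable m2 : {sigma_finite_measure set T2 -> \bar R}.

Section RealFubini.
Variable f : T1 * T2 -> R.
Hypothesis if12 : (m1 \x m2)%E.-integrable setT (EFin \o f).

Lemma measurable_Rintegral_fubini :
  measurable_fun setT (fun x => Rintegral m2 setT (fun y => f (x, y))).
Proof.
apply: measurableT_comp; first exact: fine_measurable.
exact: measurable_fubini_F if12.
Qed.

Lemma Rintegral_fubini1 :
  Rintegral m1 setT (fun x => Rintegral m2 setT (fun y => f (x, y))) =
  Rintegral (m1 \x m2)%E setT f.
Proof.
rewrite /Rintegral -[in RHS](integral12_prod_meas1 if12); congr fine.
apply: ae_eq_integral => //.
- by apply/measurable_EFinP; exact: measurable_Rintegral_fubini.
- exact: measurable_fubini_F if12.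
- apply: filterS (ae_integrable1 if12) => x ix _.
  by rewrite fineK//; exact: integrable_fin_num ix.
Qed.

Lemma Rintegral_fubini2 :
  Rintegral m2 setT (fun y => Rintegral m1 setT (fun x => f (x, y))) =
  Rintegral (m1 \x m2)%E setT f.
Proof.
rewrite /Rintegral -[in RHS](integral21_prod_meas1 if12); congr fine.
apply: ae_eq_integral => //.
- apply/measurable_EFinP; apply: measurableT_comp; first exact: fine_measurable.
  exact: measurable_fubini_G if12.
- exact: measurable_fubini_G if12.
- apply: filterS (ae_integrable2 if12) => x ix _.
  by rewrite fineK//; exact: integrable_fin_num ix.
Qed.

End RealFubini.

Variable F : T1 * T2 -> R[i].
Hypothesis mF : cmeasurable F.
Hypothesis Foo : (\int[m1]_x \int[m2]_y (normc (F (x, y)))%:E < +oo)%E.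

Let iF : cintegrable (m1 \x m2)%E F.
Proof.
split => //.
rewrite (fubini_tonelli1 (fun z => (normc (F z))%:E))//.
  exact/measurable_EFinP/measurable_normc.
by move=> z; rewrite lee_fin normc_ge0.
Qed.

Lemma cmeasurable_fubini : cmeasurable (fun x => cintegral m2 (fun y => F (x, y))).
Proof.
split => /=.
  exact: (measurable_Rintegral_fubini (cintegrable_Re iF)).
exact: (measurable_Rintegral_fubini (cintegrable_Im iF)).
Qed.

Lemma cintegral_fubini :
  cintegral m1 (fun x => cintegral m2 (fun y => F (x, y))) =
  cintegral m2 (fun y => cintegral m1 (fun x => F (x, y))).
Proof.
rewrite /cintegral/=; congr (_ +i* _).
  by rewrite (Rintegral_fubini1 (cintegrable_Re iF)) (Rintegral_fubini2 (cintegrable_Re iF)).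
by rewrite (Rintegral_fubini1 (cintegrable_Im iF)) (Rintegral_fubini2 (cintegrable_Im iF)).
Qed.

Lemma ae_cintegrable_fubini : {ae m1, forall x, cintegrable m2 (fun y => F (x, y))}.
Proof.
apply: filterS (ae_integrable1 (cintegrable_norm iF)) => x /integrableP[mx xoo].
split.
- case: mF => mr mi.
  by split; [exact: (measurableT_comp mr (pair1_measurable x))|
             exact: (measurableT_comp mi (pair1_measurable x))].
- apply: le_lt_trans xoo; under [leRHS]eq_integral do
    rewrite gee0_abs ?lee_fin ?normc_ge0//.
  exact: lexx.
Qed.

Lemma cintegrable_fubini : cintegrable m1 (fun x => cintegral m2 (fun y => F (x, y))).
Proof.
split; first exact: cmeasurable_fubini.
apply: le_lt_trans Foo; apply: ae_ge0_le_integral => //.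
- by move=> x _; rewrite lee_fin normc_ge0.
- exact/measurable_EFinP/measurable_normc/cmeasurable_fubini.
- by move=> x _; apply: integral_ge0 => y _; rewrite lee_fin normc_ge0.
- apply: (measurable_fun_fubini_tonelli_F (m2 := m2) (fun z => (normc (F z))%:E)).
    exact/measurable_EFinP/measurable_normc.
  by move=> z; rewrite lee_fin normc_ge0.
- apply: ae_imply ae_cintegrable_fubini => x cx _.
  apply: (@le_trans _ _ (Rintegral m2 setT (fun y => normc (F (x, y))))%:E).
    by rewrite lee_fin; exact: normc_cintegral.
  rewrite fineK// ge0_fin_numE; first by case: cx.
  by apply: integral_ge0 => y _; rewrite lee_fin normc_ge0.
Qed.

End ComplexFubini.

Section MultiplicativeConvolution.
Context (R : realType).
Local Notation TR := (measurableTypeR R).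
Local Notation mu := (@haar R).

Let measurable_prod_mul : measurable_fun [set: TR * TR] (fun z => (z.1 * z.2 : TR)).
Proof. by apply: measurable_funM; [exact: measurable_fst|exact: measurable_snd]. Qed.

Let mu_sf : {sigma_finite_measure set TR -> \bar R} := mu.

(** Tonelli for the change of variables (h, t) |-> (h t, t), which preserves the
    product of two Haar measures: the total mass of a convolution of
    nonnegative functions is the product of the masses. *)
Lemma ge0_integral_mconv (f g : TR -> \bar R) :
  measurable_fun setT f -> measurable_fun setT g ->
  (forall t, (0 <= f t)%E) -> (forall t, (0 <= g t)%E) ->
  (\int[mu]_h \int[mu]_t (f (h * t)%R * g t) =
   (\int[mu]_t f t) * (\int[mu]_t g t))%E.
Proof.
move=> mf mg f0 g0.
pose F (z : TR * TR) : \bar R := (f (z.1 * z.2)%R * g z.2)%E.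
have mF : measurable_fun setT F.
  apply: emeasurable_funM; first exact: measurableT_comp.
  by apply: measurableT_comp => //; exact: measurable_snd.
have F0 z : (0 <= F z)%E by rewrite mule_ge0.
rewrite [LHS](fubini_tonelli (m1 := mu_sf) (m2 := mu_sf) F)//.
transitivity (\int[mu]_t ((\int[mu]_s f s) * g t))%E; last first.
  by rewrite ge0_integralZl// integral_ge0.
apply: ge0_ae_eq_integral => //.
- exact: (measurable_fun_fubini_tonelli_G (m1 := mu_sf) F).
- exact: emeasurable_funM.
- by move=> t _; apply: integral_ge0.
- by move=> t _; rewrite mule_ge0// integral_ge0.
- apply: ae_imply (@ae_neq0 R) => t t0 _; rewrite /F/=.
  rewrite ge0_integralZr//; last exact: measurableT_comp (measurable_mulr t).
  by rewrite ge0_integral_haar_scale.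
Qed.

Lemma cintegral_mconv (f g : TR -> R[i]) : cintegrable mu f -> cintegrable mu g ->
  [/\ cintegrable mu (fun h : TR => cintegral mu (fun t => f (h * t) * g t)),
      {ae mu, forall h, cintegrable mu (fun t => f (h * t) * g t)} &
      cintegral mu (fun h => cintegral mu (fun t => f (h * t) * g t)) =
      cintegral mu f * cintegral mu g].
Proof.
move=> cf cg; have [mf foo] := cf; have [mg goo] := cg.
pose F (z : TR * TR) := f (z.1 * z.2) * g z.2.
have mF : cmeasurable F.
  apply: cmeasurableM; first exact: (cmeasurable_comp measurable_prod_mul).
  exact: (cmeasurable_comp measurable_snd).
have Foo : (\int[mu]_x \int[mu]_y (normc (F (x, y)))%:E < +oo)%E.
  under eq_integral do under eq_integral do rewrite Normc.normcM EFinM.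
  rewrite (ge0_integral_mconv (f := fun t => (normc (f t))%:E) (g := fun t => (normc (g t))%:E)).
  - have int_ge0 (h : TR -> R[i]) : (0 <= \int[mu]_t (normc (h t))%:E)%E.
      by apply: integral_ge0 => t _; rewrite lee_fin normc_ge0.
    by rewrite lte_mul_pinfty// ge0_fin_numE.
  - exact/measurable_EFinP/measurable_normc.
  - exact/measurable_EFinP/measurable_normc.
  - by move=> t; rewrite lee_fin normc_ge0.
  - by move=> t; rewrite lee_fin normc_ge0.
split.
- exact: (cintegrable_fubini (m1 := mu_sf) (m2 := mu_sf) mF Foo).
- exact: (ae_cintegrable_fubini (m1 := mu_sf) (m2 := mu_sf) mF Foo).
- rewrite [LHS](cintegral_fubini (m1 := mu_sf) (m2 := mu_sf) mF Foo).
  rewrite -cintegralZ//.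
  apply: cintegral_ae_eq => //.
  + have Foo' : (\int[mu]_y \int[mu]_x (normc (F (x, y)))%:E < +oo)%E.
      rewrite -(fubini_tonelli (m1 := mu_sf) (m2 := mu_sf) (fun z => (normc (F z))%:E))//.
        exact/measurable_EFinP/measurable_normc.
      by move=> z; rewrite lee_fin normc_ge0.
    have mF' : cmeasurable (fun z : TR * TR => F (z.2, z.1)).
      exact: (cmeasurable_comp (@measurable_swap _ _ TR TR) mF).
    exact: (cmeasurable_fubini (m1 := mu_sf) (m2 := mu_sf) mF' Foo').
  + by apply: cmeasurableM => //; exact: cmeasurable_cst.
  + apply: ae_imply (@ae_neq0 R) => t t0; rewrite /F/=.
    transitivity (cintegral mu (fun h : TR => g t * f (h * t))).
      by apply: eq_cintegral => h; rewrite mulrC.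
    rewrite cintegralZ; last exact: cintegrable_scale.
    by rewrite cintegral_haar_scale// mulrC.
Qed.

End MultiplicativeConvolution.
(** * The real-valued norm and the complex L^p spaces *)

Section RealNorm.
Context (R : realType) (V : normedModType R[i]).
Implicit Types u v : V.

Lemma rnormE v : `|v| = (rnorm v)%:C.
Proof.
rewrite /rnorm; have := normr_ge0 v; rewrite lecE => /andP[/eqP vi _].
by apply/eqP; rewrite eq_complex/= vi !eqxx.
Qed.

Lemma rnorm_ge0 v : 0 <= rnorm v.
Proof. by have := normr_ge0 v; rewrite rnormE -[0]/((0 : R)%:C) lecR. Qed.

Lemma rnormD u v : rnorm (u + v) <= rnorm u + rnorm v.
Proof. by rewrite -lecR rmorphD/= -!rnormE ler_normD. Qed.

Lemma rnormN v : rnorm (- v) = rnorm v.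
Proof. by rewrite /rnorm normrN. Qed.

Lemma rnormB u v : rnorm (u - v) <= rnorm u + rnorm v.
Proof. by rewrite -(rnormN v) rnormD. Qed.

Lemma rnormBC u v : rnorm (u - v) = rnorm (v - u).
Proof. by rewrite -rnormN opprB. Qed.

Lemma rnormZ (a : R[i]) v : rnorm (a *: v) = normc a * rnorm v.
Proof.
by apply/complexI; rewrite -rnormE normrZ rnormE rmorphM/=.
Qed.

Lemma rnorm0 : rnorm (0 : V) = 0.
Proof. by rewrite /rnorm normr0. Qed.

Lemma rnorm_eq0 v : rnorm v = 0 -> v = 0.
Proof. by move=> v0; apply/eqP; rewrite -normr_eq0 rnormE v0. Qed.

Lemma rnorm_dist_trans u v w : rnorm (u - w) <= rnorm (u - v) + rnorm (v - w).
Proof. by apply: le_trans (rnormD _ _); rewrite addrA subrK. Qed.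

Lemma rnorm_sum I (s : seq I) (F : I -> V) :
  rnorm (\sum_(i <- s) F i) <= \sum_(i <- s) rnorm (F i).
Proof.
elim: s => [|i s ih]; first by rewrite !big_nil rnorm0.
by rewrite !big_cons (le_trans (rnormD _ _))// lerD2l.
Qed.

Lemma cvg_rnorm (u_ : nat -> V) v : u_ n @[n --> \oo] --> v ->
  rnorm (u_ n - v) @[n --> \oo] --> (0 : R).
Proof.
move=> uv; apply/cvgrPdist_lt => e e0.
have e0' : 0 < e%:C by rewrite ltcR.
move/cvgrPdist_lt : uv => /(_ _ e0'); apply: filterS => n.
by rewrite rnormE ltcR sub0r normrN ger0_norm ?rnorm_ge0// rnormBC.
Qed.

End RealNorm.

Lemma rnorm_scalar (R : realType) (z : R[i]) : rnorm (z : R[i]^o) = normc z.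
Proof. by []. Qed.

Section LpFacts.
Context d (T : measurableType d) (R : realType).
Variable mu : {measure set T -> \bar R}.
Implicit Types f g : T -> R[i].

Lemma cintegral_hoelder (p q : R) f g : 0 < p -> 0 < q -> p^-1 + q^-1 = 1 ->
  cmeasurable f -> cmeasurable g ->
  (\int[mu]_t (normc (f t * g t))%:E <= cLnorm mu p f * cLnorm mu q g)%E.
Proof.
move=> p0 q0 pq mf mg.
have := hoelder mu (measurable_normc mf) (measurable_normc mg) p0 q0 pq.
rewrite Lnorm1; apply: le_trans; rewrite le_eqVlt; apply/orP; left; apply/eqP.
apply: eq_integral => t _ /=.
by rewrite Normc.normcM ger0_norm// mulr_ge0// normc_ge0.
Qed.

Variables (p : R) (p1 : 1 <= p).
Local Notation Lp := (Lp mu p1).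
Implicit Types x y : Lp.

Let p0 : 0 < p. Proof. exact: lt_le_trans p1. Qed.

Lemma rnorm_Lp x : (rnorm x)%:E = cLnorm mu p (Lp_repr x).
Proof. by rewrite /rnorm /= fineK// cLnorm_fin. Qed.

Lemma Lp_meas x : cmeasurable (Lp_repr x).
Proof. exact: cLfun_meas. Qed.

Lemma Lp_repr_class (u : cLfunType mu p1) : Lp_repr (Lp_class u) = u %[ae mu].
Proof. by apply/Lp_classP; exact: Lp_reprK. Qed.

Lemma Lp_repr_lin (a : R[i]) x y :
  {ae mu, forall t, Lp_repr (a *: x + y) t = a * Lp_repr x t + Lp_repr y t}.
Proof.
have -> : a *: x + y = Lp_class (a *: Lp_repr x + Lp_repr y).
  by rewrite Lp_classD Lp_classZ !Lp_reprK.
apply: ae_imply (Lp_repr_class (a *: Lp_repr x + Lp_repr y)) => t h.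
exact: (h I).
Qed.

Lemma Lp_ofE f : cmeasurable f -> (cLnorm mu p f < +oo)%E ->
  exists2 u : cLfunType mu p1, Lp_of mu p1 f = Lp_class u & (u : T -> R[i]) = f.
Proof.
move=> mf foo; exists (insubd 0 f) => //.
by rewrite val_insubd ifT//; apply/asboolP.
Qed.

Lemma Lp_of_repr f : cmeasurable f -> (cLnorm mu p f < +oo)%E ->
  {ae mu, forall t, Lp_repr (Lp_of mu p1 f) t = f t}.
Proof.
move=> mf foo; have [u -> uf] := Lp_ofE mf foo.
by apply: ae_imply (Lp_repr_class u) => t h; rewrite (h I) uf.
Qed.

Lemma rnorm_Lp_of f : cmeasurable f -> (cLnorm mu p f < +oo)%E ->
  (rnorm (Lp_of mu p1 f))%:E = cLnorm mu p f.
Proof.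
move=> mf foo; have [u -> uf] := Lp_ofE mf foo.
by rewrite rnorm_Lp (cLnorm_ae (Lp_repr_class u)) uf.
Qed.

Lemma Lp_eq_ae x y : {ae mu, forall t, Lp_repr x t = Lp_repr y t} -> x = y.
Proof.
move=> xy; rewrite -(Lp_reprK x) -(Lp_reprK y); apply/Lp_classP.
by apply: ae_imply xy => t h _.
Qed.

End LpFacts.

(** * Projective tensor products *)

Section ProjectiveTensorTheory.
Context (R : realType) (X Y : normedModType R[i]) (A : completeNormedModType R[i]).
Variable ten : X -> Y -> A.
Hypothesis Aten : is_projective_tensor ten.

Section Sums.
Context (Z : lmodType R[i]) (b : X -> Y -> Z).

Lemma tensor_sum_cat s s' :
  tensor_sum b (s ++ s') = tensor_sum b s + tensor_sum b s'.
Proof. by rewrite /tensor_sum big_cat. Qed.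

Hypothesis bil : bilinear_map b.

Lemma bilinearDl x x' y : b (x + x') y = b x y + b x' y.
Proof. by have [_ /(_ y 1 x x')] := bil; rewrite !scale1r. Qed.

Lemma bilinearDr x y y' : b x (y + y') = b x y + b x y'.
Proof. by have [/(_ x 1 y y') + _] := bil; rewrite !scale1r. Qed.

Lemma bilinear0l y : b 0 y = 0.
Proof. by apply: (addrI (b 0 y)); rewrite -bilinearDl !addr0. Qed.

Lemma bilinear0r x : b x 0 = 0.
Proof. by apply: (addrI (b x 0)); rewrite -bilinearDr !addr0. Qed.

Lemma bilinearZl a x y : b (a *: x) y = a *: b x y.
Proof. by have [_ /(_ y a x 0)] := bil; rewrite !addr0 bilinear0l addr0. Qed.

Lemma bilinearZr a x y : b x (a *: y) = a *: b x y.
Proof. by have [/(_ x a y 0) + _] := bil; rewrite !addr0 bilinear0r addr0. Qed.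

Lemma bilinearBl x x' y : b (x - x') y = b x y - b x' y.
Proof. by rewrite -[in LHS]scaleN1r bilinearDl bilinearZl scaleN1r. Qed.

Lemma bilinearBr x y y' : b x (y - y') = b x y - b x y'.
Proof. by rewrite -[in LHS]scaleN1r bilinearDr bilinearZr scaleN1r. Qed.

Lemma bilinear_suml I (s : seq I) (F : I -> X) y :
  b (\sum_(i <- s) F i) y = \sum_(i <- s) b (F i) y.
Proof.
elim: s => [|i s ih]; first by rewrite !big_nil bilinear0l.
by rewrite !big_cons bilinearDl ih.
Qed.

Lemma bilinear_sumr I (s : seq I) x (F : I -> Y) :
  b x (\sum_(i <- s) F i) = \sum_(i <- s) b x (F i).
Proof.
elim: s => [|i s ih]; first by rewrite !big_nil bilinear0r.
by rewrite !big_cons bilinearDr ih.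
Qed.

Definition tensor_scale (a : R[i]) (s : seq (X * Y)) := [seq (a *: w.1, w.2) | w <- s].

Lemma tensor_sum_scale a s : tensor_sum b (tensor_scale a s) = a *: tensor_sum b s.
Proof.
rewrite /tensor_sum big_map scaler_sumr; apply: eq_bigr => w _ /=.
by rewrite bilinearZl.
Qed.

End Sums.

Lemma rnorm_ten x y : rnorm (ten x y) <= rnorm x * rnorm y.
Proof.
have [_ + _] := Aten => /(_ [:: (x, y)]).
rewrite /tensor_sum big_seq1/= => ->; apply: ge_inf.
  exists 0 => _ [s' _ ->]; apply: sumr_ge0 => w _.
  by rewrite mulr_ge0// rnorm_ge0.
by exists [:: (x, y)]; rewrite ?big_seq1.
Qed.

Lemma tensor_sum_dense u (e : R) : 0 < e ->
  exists s, rnorm (tensor_sum ten s - u) < e.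
Proof.
move=> e0; have [_ _ dn] := Aten.
have eC : 0 < e%:C by rewrite ltcR.
have [] := dn (ball u e%:C); first by exists u; exact: ballxx.
  exact: ball_open.
move=> v [+ [s _ sv]]; rewrite -sv -ball_normE/= rnormE ltcR rnormBC.
by exists s.
Qed.

(** The sum depends only on the tensor represented by s, so it is bounded along
    every representation of that tensor; the projective norm is the infimum of
    these bounds. *)
Lemma bounded_tensor_sum (Z : normedModType R[i]) (b : X -> Y -> Z) (M : R) s :
  bilinear_map b -> 0 <= M ->
  (forall x y, rnorm (b x y) <= M * (rnorm x * rnorm y)) ->
  rnorm (tensor_sum b s) <= M * rnorm (tensor_sum ten s).
Proof.
move=> bb M0 bM; have [_ -> _] := Aten.
have h s' : tensor_eq s s' ->
    rnorm (tensor_sum b s) <= M * \sum_(w <- s') rnorm w.1 * rnorm w.2.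
  move=> /(_ _ _ bb) ->; rewrite mulr_sumr (le_trans (rnorm_sum _ _))//.
  by apply: ler_sum => w _; exact: bM.
have [M_0|M0'] := eqVneq M 0.
  by have := h s (fun _ _ _ => erefl); rewrite M_0 !mul0r.
have {M0'}M0' : 0 < M by rewrite lt_neqAle eq_sym M0'.
rewrite -ler_pdivrMl//; apply: lb_le_inf.
  by exists (\sum_(w <- s) rnorm w.1 * rnorm w.2); exists s.
by move=> _ [s' ss' ->]; rewrite ler_pdivrMl// h.
Qed.

(** The extension by continuity of the bounded bilinear map [b] to the
    completed tensor product vanishes at [u].  Phrasing it as an estimate on
    finite sums dispenses with constructing the extension. *)
Definition vanishes_at (Z : normedModType R[i]) (b : X -> Y -> Z) (M : R) (u : A) :=
  forall s, rnorm (tensor_sum b s) <= M * rnorm (tensor_sum ten s - u).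

(** Comparison with a finite sum very close to u replaces an arbitrary constant
    by a bound of b. Constants independent of n are what [vanishes_cvg] and the
    conditional expectations below require. *)
Lemma vanishes_sharpen (Z : normedModType R[i]) (b : X -> Y -> Z) (M M0 : R) u :
  bilinear_map b -> 0 <= M ->
  (forall x y, rnorm (b x y) <= M * (rnorm x * rnorm y)) ->
  vanishes_at b M0 u -> vanishes_at b M u.
Proof.
have [bten _ _] := Aten.
move=> bb M_ge0 bM v0 s; apply/ler_addgt0Pl => e e0.
pose C := M + `|M0| + 1.
have C0 : 0 < C by rewrite /C ltr_wpDl// addr_ge0.
have [s' s'u] := tensor_sum_dense u (divr_gt0 e0 C0).
have -> : tensor_sum b s = tensor_sum b (s ++ tensor_scale (-1) s') + tensor_sum b s'.
  by rewrite tensor_sum_cat tensor_sum_scale// scaleN1r subrK.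
rewrite (le_trans (rnormD _ _))//.
apply: le_trans (lerD (bounded_tensor_sum _ bb M_ge0 bM) (v0 s')) _.
rewrite tensor_sum_cat tensor_sum_scale// scaleN1r.
apply: (@le_trans _ _ (M * (rnorm (tensor_sum ten s - u) + rnorm (tensor_sum ten s' - u))
    + `|M0| * rnorm (tensor_sum ten s' - u))).
  apply: lerD; last by rewrite ler_wpM2r ?rnorm_ge0// ler_norm.
  rewrite ler_wpM2l//; have := rnorm_dist_trans (tensor_sum ten s) u (tensor_sum ten s').
  by rewrite (rnormBC u).
apply: (@le_trans _ _ (C * rnorm (tensor_sum ten s' - u) + M * rnorm (tensor_sum ten s - u))).
  rewrite /C !mulrDl mulrDr mul1r; have := rnorm_ge0 (tensor_sum ten s' - u); lra.
by rewrite lerD2r mulrC -ler_pdivlMr// ltW.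
Qed.

Lemma vanishes_lin (Z : normedModType R[i]) (b b' : X -> Y -> Z) (M M' : R) a u :
  vanishes_at b M u -> vanishes_at b' M' u ->
  vanishes_at (fun x y => a *: b x y + b' x y) (normc a * M + M') u.
Proof.
move=> v v' s; rewrite /tensor_sum big_split/= -scaler_sumr.
rewrite (le_trans (rnormD _ _))// mulrDl lerD//; last exact: v'.
by rewrite rnormZ -mulrA ler_wpM2l ?normc_ge0//; exact: v.
Qed.

Lemma vanishes_scale (b : X -> Y -> R[i]) (M : R) (Z : normedModType R[i]) (c : R[i]) (v : Z) u :
  vanishes_at (b : X -> Y -> R[i]^o) M u ->
  vanishes_at (fun x y => (c * b x y) *: v) (normc c * rnorm v * M) u.
Proof.
move=> vb s; rewrite /tensor_sum -scaler_suml -mulr_sumr rnormZ Normc.normcM.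
rewrite mulrAC -!mulrA ler_wpM2l ?normc_ge0// ler_wpM2l ?rnorm_ge0//; exact: vb.
Qed.

Lemma vanishes_sum (Z : normedModType R[i]) I (r : seq I) (b_ : I -> X -> Y -> Z) u :
  (forall i, exists M, vanishes_at (b_ i) M u) ->
  exists M, vanishes_at (fun x y => \sum_(i <- r) b_ i x y) M u.
Proof.
move=> /choice[M v]; exists (\sum_(i <- r) M i) => s.
rewrite /tensor_sum exchange_big/= mulr_suml (le_trans (rnorm_sum _ _))//.
by apply: ler_sum => i _; exact: v.
Qed.

Lemma vanishes_cvg (Z : normedModType R[i]) (b_ : nat -> X -> Y -> Z) (b : X -> Y -> Z)
    (M : R) u :
  (forall n, vanishes_at (b_ n) M u) ->
  (forall x y, rnorm (b_ n x y - b x y) @[n --> \oo] --> (0 : R)) ->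
  vanishes_at b M u.
Proof.
move=> v cb s.
have cs : rnorm (tensor_sum (b_ n) s - tensor_sum b s) @[n --> \oo] --> (0 : R).
  apply: (@squeeze_cvg0 _ _ (fun n => \sum_(w <- s) rnorm (b_ n w.1 w.2 - b w.1 w.2))).
    by move=> n; rewrite rnorm_ge0/= /tensor_sum -sumrB rnorm_sum.
  elim: s => [|w s ih].
    by under eq_fun do rewrite big_nil; exact: cvg_cst.
  under eq_fun do rewrite big_cons.
  by have := cvgD (cb w.1 w.2) ih; rewrite addr0 => h; exact: h.
apply/ler_addgt0Pl => e e0.
move/cvgrPdist_lt : cs => /(_ _ e0)[n _ /(_ n (leqnn n))].
rewrite sub0r normrN ger0_norm ?rnorm_ge0// => h.
rewrite -[tensor_sum b s](subKr (tensor_sum (b_ n) s)) (le_trans (rnormB _ _))//.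
by rewrite addrC lerD// ?v// ltW.
Qed.

End ProjectiveTensorTheory.
(** * Bochner integrals and functionals *)

Section BochnerFunctional.
Context d (T : measurableType d) (R : realType).
Variable mu : {measure set T -> \bar R}.

(** The integral of an arbitrary nonnegative function is the supremum of the
    integrals of the simple functions below it, so monotonicity needs no
    measurability. *)
Lemma ge0_le_integral_nonmeasurable (f g : T -> \bar R) :
  (forall t, (0 <= f t)%E) -> (forall t, (f t <= g t)%E) ->
  (\int[mu]_t f t <= \int[mu]_t g t)%E.
Proof.
move=> f0 fg; have g0 t : (0 <= g t)%E by exact: le_trans (f0 t) (fg t).
rewrite ge0_integralTE// ge0_integralTE//.
apply: le_ereal_sup => _ [h hf <-]; exists h => // t.
exact: le_trans (hf t) (fg t).
Qed.

Lemma cintegral_indic (B : set T) : measurable B -> (mu B < +oo)%E ->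
  cintegrable mu (fun t => (\1_B t : R[i])) /\
  cintegral mu (fun t => (\1_B t : R[i])) = (fine (mu B))%:C.
Proof.
move=> mB Boo; have e : (fun t => (\1_B t : R[i])) = fun t => ((\1_B t : R))%:C.
  by apply/funext => t; rewrite !indicE; case: (t \in B).
split.
  split; first exact: cmeasurable_indic.
  rewrite (eq_integral (fun t => (\1_B t : R)%:E)).
    by rewrite integral_indic// setIT.
  by move=> t _; rewrite !indicE; case: (t \in B); rewrite ?Normc.normc1 ?Normc.normc0.
rewrite e /cintegral/= /Rintegral integral_indic// setIT.
by rewrite integral0.
Qed.

Variable V : normedModType R[i].

Lemma sm_fun_functional (phi : V -> R[i]) (s : simple_map mu V) :
  (forall a u v, phi (a *: u + v) = a * phi u + phi v) ->
  cintegrable mu (fun t => phi (sm_fun s t)) /\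
  cintegral mu (fun t => phi (sm_fun s t)) = phi (sm_integral s).
Proof.
move=> lin.
have phi0 : phi 0 = 0.
  by have := lin 1 0 0; rewrite scale1r addr0 mul1r -[in LHS](addr0 (phi 0)) => /addrI.
have phi_sum n (c : 'I_n -> R[i]) (v : 'I_n -> V) :
    phi (\sum_(i < n) c i *: v i) = \sum_(i < n) c i * phi (v i).
  by elim/big_rec2: _ => // i x y _ <-; rewrite lin.
rewrite (_ : (fun t => _) = fun t => \sum_(i < sm_size s)
    phi (sm_val i) * (\1_(sm_set i) t : R[i])); last first.
  by apply/funext => t; rewrite phi_sum; apply: eq_bigr => i _; rewrite mulrC.
have ci (i : 'I_(sm_size s)) := cintegral_indic (sm_measurable i) (sm_finite i).
have [c e] := @cintegral_sum _ _ _ mu _ (index_enum 'I_(sm_size s))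
  (fun i t => phi (sm_val i) * (\1_(sm_set i) t : R[i]))
  (fun i => cintegrableZ _ (ci i).1).
split => //; rewrite e phi_sum; apply: eq_bigr => i _.
rewrite cintegralZ; last exact: (ci i).1.
by rewrite (ci i).2; exact: mulrC.
Qed.

(** The images under phi of the simple maps converge to k in L^1, and for simple
    maps the claim is the linearity of phi. *)
Lemma Bochner_functional (phi : V -> R[i]) (f : T -> V) (I : V) (k : T -> R[i]) :
  (forall a u v, phi (a *: u + v) = a * phi u + phi v) ->
  (forall v, normc (phi v) <= rnorm v) ->
  is_Bochner_integral mu f I -> cmeasurable k ->
  {ae mu, forall t, phi (f t) = k t} -> cintegral mu k = phi I.
Proof.
move=> lin phi1 [s [_ cf cI]] mk [N [mN N0 fk]].
have phiB u v : phi (u - v) = phi u - phi v.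
  by rewrite -scaleN1r addrC lin mulN1r addrC.
pose S n t := phi (sm_fun (s n) t).
have cS n : cintegrable mu (S n) := (sm_fun_functional (s n) lin).1.
have mS n : cmeasurable (S n) by case: (cS n).
have mkS n : measurable_fun setT (fun t => (normc (k t - S n t))%:E).
  exact/measurable_EFinP/measurable_normc/cmeasurableB.
have le n : (\int[mu]_t (normc (k t - S n t))%:E <=
             \int[mu]_t (rnorm (f t - sm_fun (s n) t))%:E)%E.
  rewrite (_ : \int[mu]_t (normc (k t - S n t))%:E =
      \int[mu]_t ((fun t => (normc (k t - S n t))%:E) \_ (setT `\` N)) t)%E; last first.
    rewrite -integral_mkcond (ge0_negligible_integral mN)// => t _.
    by rewrite lee_fin normc_ge0.
  apply: ge0_le_integral_nonmeasurable => t; rewrite patchE; case: ifPn => //.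
  - by rewrite lee_fin normc_ge0.
  - rewrite inE => /= -[_ Nt]; rewrite lee_fin.
    have -> : k t = phi (f t) by apply: contrapT => h; apply: Nt; apply: fk => /=; exact/nesym.
    by rewrite -phiB; exact: phi1.
  - by move=> _; rewrite lee_fin rnorm_ge0.
have cvgS : (\int[mu]_t (normc (k t - S n t))%:E)%E @[n --> \oo] --> 0%E.
  apply: (@squeeze_cvge _ _ _ _ (fun=> 0%E) _
    (fun n => \int[mu]_t (rnorm (f t - sm_fun (s n) t))%:E)%E) => //.
    apply: nearW => n; rewrite le andbT; apply: integral_ge0 => t _.
    by rewrite lee_fin normc_ge0.
  exact: cvg_cst.
have [n0 _ fin] : \forall n \near \oo, (\int[mu]_t (normc (k t - S n t))%:E)%E \is a fin_num.
  by have /fine_cvgP[] := cvgS.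
have ck : cintegrable mu k.
  have cB : cintegrable mu (fun t => k t - S n0 t).
    split; first exact: cmeasurableB.
    by have := fin n0 (leqnn n0); rewrite ge0_fin_numE// integral_ge0// => t _;
      rewrite lee_fin normc_ge0.
  have := cintegrableD cB (cS n0).
  by under eq_fun do rewrite subrK.
have c1 : normc (cintegral mu k - phi (sm_integral (s n))) @[n --> \oo] --> (0 : R).
  have /fine_cvg h := cvgS; apply: squeeze_cvg0 h => n; rewrite normc_ge0/=.
  have -> : cintegral mu k - phi (sm_integral (s n)) = cintegral mu (fun t => k t - S n t).
    by rewrite cintegralB// (sm_fun_functional (s n) lin).2.
  exact: normc_cintegral (cintegrableB ck (cS n)).
have c2 := cvg_rnorm cI.
apply/eqP; rewrite -subr_eq0; apply/eqP; apply: Normc.eq0_normc; apply/eqP.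
rewrite eq_le normc_ge0 andbT.
apply/ler_addgt0Pl => e e0; have e20 : 0 < e / 2 by rewrite divr_gt0.
move/cvgrPdist_lt : c1 => /(_ _ e20)[n1 _ h1].
move/cvgrPdist_lt : c2 => /(_ _ e20)[n2 _ h2].
have := h1 (maxn n1 n2) (leq_maxl _ _); have := h2 (maxn n1 n2) (leq_maxr _ _).
rewrite /= !sub0r !normrN (ger0_norm (rnorm_ge0 _)) (ger0_norm (normc_ge0 _)) => g2 g1.
set J := sm_integral _ in g1 g2.
have -> : cintegral mu k - phi I = (cintegral mu k - phi J) + phi (J - I).
  by rewrite phiB addrA subrK.
rewrite addr0 (le_trans (normcD _ _))// (splitr e) lerD ?(ltW g1)//.
by rewrite (le_trans (phi1 _))// ltW.
Qed.

End BochnerFunctional.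

(** * Coefficient functionals *)

Section Coefficients.
Context (R : realType) (p q : R) (p1 : 1 <= p) (q1 : 1 <= q).
Hypothesis pq : p^-1 + q^-1 = 1.
Local Notation TR := (measurableTypeR R).
Local Notation mu := (@haar R).
Local Notation X := (LpRx p1).
Local Notation Y := (LpRx q1).

Let p0 : 0 < p. Proof. exact: lt_le_trans p1. Qed.
Let q0 : 0 < q. Proof. exact: lt_le_trans q1. Qed.

(** For w = cis (2 pi b -) these are the matrix coefficients at (b, a) of the
    representation of the affine group on L^p; general bounded weights w appear
    as limits of combinations of these. *)
Definition coef (a : R) (w : TR -> R[i]) (x : X) (y : Y) : R[i] :=
  cintegral mu (fun t => w t * Lp_repr x (t * a) * Lp_repr y t).

Lemma coef_hoelder (a : R) (x : X) (y : Y) : a != 0 ->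
  (\int[mu]_t (normc (Lp_repr x (t * a) * Lp_repr y t))%:E <=
   (rnorm x * rnorm y)%:E)%E.
Proof.
move=> a0.
have mx : cmeasurable (fun t : TR => Lp_repr x (t * a)).
  by apply: cmeasurable_scale; exact: Lp_meas.
apply: le_trans (cintegral_hoelder mu p0 q0 pq mx (Lp_meas y)) _.
rewrite cLnorm_scale//; last exact: Lp_meas.
by rewrite -!rnorm_Lp EFinM.
Qed.

Lemma coef_cintegrable1 (a : R) (x : X) (y : Y) : a != 0 ->
  cintegrable mu (fun t : TR => Lp_repr x (t * a) * Lp_repr y t).
Proof.
move=> a0; split.
  apply: cmeasurableM; last exact: Lp_meas.
  by apply: cmeasurable_scale; exact: Lp_meas.
by apply: le_lt_trans (coef_hoelder x y a0) _; rewrite ltry.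
Qed.

Lemma coef_cintegrable (M a : R) (w : TR -> R[i]) (x : X) (y : Y) : a != 0 ->
  cmeasurable w -> (forall t, normc (w t) <= M) ->
  cintegrable mu (fun t : TR => w t * Lp_repr x (t * a) * Lp_repr y t).
Proof.
move=> a0 mw wM; have := cintegrableMb (coef_cintegrable1 x y a0) mw wM.
by under eq_fun do rewrite mulrA.
Qed.

Lemma coef_bound (M a : R) (w : TR -> R[i]) (x : X) (y : Y) : a != 0 ->
  cmeasurable w -> (forall t, normc (w t) <= M) ->
  normc (coef a w x y) <= M * (rnorm x * rnorm y).
Proof.
move=> a0 mw wM; have M0 : 0 <= M := le_trans (normc_ge0 _) (wM 0).
have cxy := coef_cintegrable1 x y a0.
apply: le_trans (normc_cintegral (coef_cintegrable x y a0 mw wM)) _.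
apply: (@le_trans _ _ (Rintegral mu setT
    (fun t => M * normc (Lp_repr x (t * a) * Lp_repr y t)))).
  apply: le_Rintegral => //.
  - exact: (cintegrable_norm (coef_cintegrable x y a0 mw wM)).
  - have := integrableZl measurableT M (cintegrable_norm cxy).
    by apply: eq_integrable => // t _; rewrite /= EFinM.
  - by move=> t _; rewrite -mulrA Normc.normcM ler_wpM2r ?normc_ge0.
rewrite RintegralZl//; last exact: cintegrable_norm.
rewrite ler_wpM2l// -lee_fin fineK; first exact: coef_hoelder.
rewrite ge0_fin_numE; first by case: cxy.
by apply: integral_ge0 => t _; rewrite lee_fin normc_ge0.
Qed.

Lemma coef_bilinear (M a : R) (w : TR -> R[i]) : a != 0 ->
  cmeasurable w -> (forall t, normc (w t) <= M) ->
  bilinear_map (coef a w : X -> Y -> R[i]^o).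
Proof.
move=> a0 mw wM.
have int (x : X) (y : Y) := coef_cintegrable x y a0 mw wM.
have mm (x : X) (y : Y) : cmeasurable (fun t : TR => w t * Lp_repr x (t * a) * Lp_repr y t).
  by case: (int x y).
split=> [x c y y'|y c x x'].
  rewrite /coef -[RHS]/(c * _ + _) -cintegralZ// -cintegralD//; last exact: cintegrableZ.
  apply: cintegral_ae_eq; [exact: mm| |].
    by apply: cmeasurableD => //; exact: cmeasurableZ.
  apply: ae_imply (Lp_repr_lin c y y') => t -> _; ring.
rewrite /coef -[RHS]/(c * _ + _) -cintegralZ// -cintegralD//; last exact: cintegrableZ.
apply: cintegral_ae_eq; [exact: mm| |].
  by apply: cmeasurableD => //; exact: cmeasurableZ.
apply: ae_imply (ae_scale a0 (Lp_repr_lin c x x')) => t -> _; ring.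
Qed.

End Coefficients.
(** * Multiplicativity of Psi *)

Section Twist.
Context (R : realType).
Local Notation TR := (measurableTypeR R).
Local Notation mu := (@haar R).

Lemma cmeasurable_cis (b : R) : cmeasurable (fun t : TR => cis (b * t)).
Proof.
have mb : measurable_fun [set: TR] (fun t : TR => b * t).
  by apply: measurable_funM => //; exact: measurable_cst.
split => /=.
  apply: (measurableT_comp _ mb); apply: continuous_measurable_fun; exact: continuous_cos.
apply: (measurableT_comp _ mb); apply: continuous_measurable_fun; exact: continuous_sin.
Qed.

Lemma ae_twist_dom : {ae mu, forall h : TR, h != 0 /\ 1 + h != 0}.
Proof.
have c : mu [set -1] = 0%E by rewrite /haar integral_set1.
have ae1 : {ae mu, forall h : TR, h != -1}.
  exists [set -1]; split => // h /= /negP; rewrite negbK => /eqP; exact.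
have ae0 := @ae_neq0 R.
near=> h; split; first exact: (near ae0 h).
rewrite addrC -[1]opprK subr_eq0; exact: (near ae1 h).
Unshelve. all: by end_near. Qed.

(** Dilations preserve Haar integrals and L^p norms, so for these purposes the
    twisted product is as good as t |-> f t * f' (h t). *)
Lemma twistE (h : R) (f f' : TR -> R[i]) t : h != 0 -> 1 + h != 0 ->
  twist h f f' t = f (t * (1 + h)^-1) * f' (h * (t * (1 + h)^-1)).
Proof.
move=> h0 h1; rewrite /twist /lambda mulrC [in RHS]mulrC (mulrC _ t).
congr (f' _ * _); last by rewrite mulrC.
have -> : 1 + h^-1 = (1 + h) / h by rewrite mulrDl mulfV// mul1r addrC.
by rewrite invf_div; ring.
Qed.

Lemma twist_meas (h : R) (f f' : TR -> R[i]) : cmeasurable f -> cmeasurable f' ->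
  cmeasurable (twist h f f' : TR -> R[i]).
Proof.
move=> mf mf'; have m g r : cmeasurable g -> cmeasurable (lambda r g : TR -> R[i]).
  move=> mg; have := cmeasurable_scale r^-1 mg.
  by under eq_fun do rewrite mulrC.
exact: cmeasurableM (m _ _ mf) (m _ _ mf').
Qed.

(** By Tonelli, the p-th powers of the L^p norms of the twisted products have a
    finite integral over h. *)
Lemma ae_twist_Lp (p : R) (f f' : TR -> R[i]) : 0 < p -> cmeasurable f -> cmeasurable f' ->
  (cLnorm mu p f < +oo)%E -> (cLnorm mu p f' < +oo)%E ->
  {ae mu, forall h, h != 0 -> 1 + h != 0 ->
    (cLnorm mu p (twist h f f' : TR -> R[i]) < +oo)%E}.
Proof.
move=> p0 mf mf' foo f'oo.
have cpow g : cmeasurable g -> (cLnorm mu p g < +oo)%E ->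
    cintegrable mu (fun t => (normc (g t) `^ p)%:C).
  move=> mg goo; split.
    apply: cmeasurable_real; apply: (measurableT_comp (measurable_powR _)) => //.
    exact: measurable_normc.
  under eq_integral do rewrite normc_real ger0_norm ?powR_ge0//.
  have : (cLnorm mu p g `^ p < +oo)%E by rewrite poweR_lty.
  rewrite cLnormE -poweRrM mulVf ?gt_eqF// poweRe1//.
  by apply: integral_ge0 => t _; rewrite lee_fin powR_ge0.
have [_ + _] := cintegral_mconv (cpow _ mf' f'oo) (cpow _ mf foo).
apply: ae_imply => h [_ hoo] h0 h1.
pose G t := f t * f' (h * t).
have mG : cmeasurable G.
  apply: cmeasurableM => //; have := cmeasurable_scale h mf'.
  by under eq_fun do rewrite mulrC.
rewrite (_ : twist h f f' = fun t => G (t * (1 + h)^-1)); last first.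
  by apply/funext => t; rewrite twistE.
rewrite cLnorm_scale ?invr_neq0// cLnormE poweR_lty//.
apply: le_lt_trans hoo; rewrite le_eqVlt; apply/orP; left; apply/eqP.
apply: eq_integral => t _.
rewrite /G !Normc.normcM powRM ?normc_ge0// !normc_real !ger0_norm ?powR_ge0//.
by rewrite mulrC.
Qed.

End Twist.

Section Multiplicativity.
Context (R : realType) (p q : R) (p1 : 1 <= p) (q1 : 1 <= q).
Hypothesis pq : p^-1 + q^-1 = 1.
Local Notation TR := (measurableTypeR R).
Local Notation mu := (@haar R).
Local Notation X := (LpRx p1).
Local Notation Y := (LpRx q1).
Context (A : completeNormedModType R[i]) (ten : X -> Y -> A).
Context (box : A -> A -> A) (Psi : A -> affine R -> R[i]).
Hypotheses (Aten : is_projective_tensor ten) (Abox : is_boxtimes ten box).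
Hypothesis APsi : is_Psi ten Psi.

Let p0 : 0 < p. Proof. exact: lt_le_trans p1. Qed.
Let q0 : 0 < q. Proof. exact: lt_le_trans q1. Qed.

Lemma PsiE (x : X) (y : Y) (g : affine R) :
  Psi (ten x y) g = coef (dil g) (fun t => cis (2 * pi * g.1 * t)) x y.
Proof. by case: APsi => _ _ _ ->. Qed.

Lemma Psi_lin (g : affine R) a u v : Psi (a *: u + v) g = a * Psi u g + Psi v g.
Proof. by case: APsi => -> _ _ _. Qed.

Lemma Psi_bound u (g : affine R) : normc (Psi u g) <= rnorm u.
Proof. by case: APsi. Qed.

Lemma PsiB u v (g : affine R) : Psi (u - v) g = Psi u g - Psi v g.
Proof. by rewrite -scaleN1r addrC Psi_lin mulN1r addrC. Qed.

Lemma Psi0 (g : affine R) : Psi 0 g = 0.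
Proof. by rewrite -(subrr 0) PsiB subrr. Qed.

Lemma Psi_sum I (s : seq I) (F : I -> A) (g : affine R) :
  Psi (\sum_(i <- s) F i) g = \sum_(i <- s) Psi (F i) g.
Proof.
elim: s => [|i s ih]; first by rewrite !big_nil Psi0.
by rewrite !big_cons -[F i]scale1r Psi_lin mul1r ih scale1r.
Qed.

(** The substitution (s, s') = (t / (1 + h), t h / (1 + h)) turns the product of
    two coefficient integrals into the integral over h of the coefficients of
    the twisted products. *)
Lemma Psi_box_elementary (x x' : X) (y y' : Y) (g : affine R) :
  Psi (box (ten x y) (ten x' y')) g = Psi (ten x y) g * Psi (ten x' y') g.
Proof.
set a := dil g; set b := 2 * pi * g.1.
have a0 : a != 0 := dil_neq0 g.
have mE : cmeasurable (fun t : TR => cis (b * t)) := cmeasurable_cis b.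
have Eb (t : TR) : normc (cis (b * t)) <= 1 by rewrite normc_cis.
pose f (t : TR) := cis (b * t) * Lp_repr x (t * a) * Lp_repr y t.
pose f' (t : TR) := cis (b * t) * Lp_repr x' (t * a) * Lp_repr y' t.
have cf : cintegrable mu f := coef_cintegrable pq x y a0 mE Eb.
have cf' : cintegrable mu f' := coef_cintegrable pq x' y' a0 mE Eb.
have [[mk _] _ ke] := cintegral_mconv cf' cf.
rewrite [RHS]mulrC !PsiE -[RHS]ke.
have [_ _ /(_ x x' y y') boch] := Abox.
have lin := Psi_lin g; have bd v := Psi_bound v g.
apply/esym; apply: (Bochner_functional (phi := fun v => Psi v g) lin bd boch mk).
have fin r (r1 : 1 <= r) (z : LpRx r1) : (cLnorm mu r (Lp_repr z) < +oo)%E.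
  by rewrite -rnorm_Lp ltry.
have hx := ae_twist_Lp p0 (Lp_meas x) (Lp_meas x') (fin _ _ x) (fin _ _ x').
have hy := ae_twist_Lp q0 (Lp_meas y) (Lp_meas y') (fin _ _ y) (fin _ _ y').
have hd := ae_twist_dom R.
near=> h.
have [h0 h1] : h != 0 /\ 1 + h != 0 by apply: (near hd h).
have xoo : (cLnorm mu p (twist h (Lp_repr x) (Lp_repr x') : TR -> R[i]) < +oo)%E.
  by apply: (near hx h).
have yoo : (cLnorm mu q (twist h (Lp_repr y) (Lp_repr y') : TR -> R[i]) < +oo)%E.
  by apply: (near hy h).
rewrite PsiE /coef -/a -/b.
have mtx := twist_meas h (Lp_meas x) (Lp_meas x').
have mty := twist_meas h (Lp_meas y) (Lp_meas y').
pose E (s : TR) := f' (h * s) * f s.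
have mE' : cmeasurable E.
  apply: cmeasurableM; last by case: cf.
  have [mf' _] := cf'; have := cmeasurable_scale h mf'.
  by under eq_fun do rewrite mulrC.
transitivity (cintegral mu (fun t => E (t * (1 + h)^-1))); last first.
  by rewrite cintegral_haar_scale ?invr_neq0.
apply: cintegral_ae_eq.
- apply: cmeasurableM; last exact: Lp_meas.
  apply: cmeasurableM; first exact: mE.
  by apply: cmeasurable_scale; exact: Lp_meas.
- exact: cmeasurable_scale.
have rx := ae_scale a0 (Lp_of_repr p1 mtx xoo).
have ry := Lp_of_repr q1 mty yoo.
near=> t => _.
rewrite (near rx t)// (near ry t)// !twistE// /E /f /f'.
set s := t * (1 + h)^-1.
have -> : t * a * (1 + h)^-1 = s * a by rewrite /s mulrAC.
have -> : b * t = b * (h * s) + b * s.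
  transitivity (b * ((1 + h) * s)); last by ring.
  by rewrite /s [(1 + h) * _]mulrCA mulfV// mulr1.
rewrite cisD (mulrA h s a); ring.
Unshelve. all: by end_near. Qed.

(** Applied in each variable separately, this extends the multiplicativity of
    Psi from elementary tensors to all of A. *)
Lemma functional_eq0 (phi : A -> R[i]) (C : R) u :
  (forall v w, phi (v - w) = phi v - phi w) -> 0 <= C ->
  (forall v, normc (phi v) <= C * rnorm v) ->
  (forall s, phi (tensor_sum ten s) = 0) -> phi u = 0.
Proof.
move=> phiB C0 phiC phi0; apply: Normc.eq0_normc; apply/eqP.
rewrite eq_le normc_ge0 andbT; apply/ler_addgt0Pl => e e0; rewrite addr0.
have C1 : 0 < C + 1 by rewrite ltr_wpDl.
have [s su] := tensor_sum_dense Aten u (divr_gt0 e0 C1).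
rewrite -[phi u]subr0 -(phi0 s) -phiB (le_trans (phiC _))// rnormBC.
apply: (@le_trans _ _ ((C + 1) * rnorm (tensor_sum ten s - u))).
  by rewrite ler_wpM2r ?rnorm_ge0// lerDl.
by rewrite mulrC -ler_pdivlMr// ltW.
Qed.

Lemma Psi_box u v : Psi (box u v) = ptwise_mul (Psi u) (Psi v).
Proof.
have [bbox box1 _] := Abox.
apply/funext => g; rewrite /ptwise_mul.
have Psi_box_sum (s s' : seq (X * Y)) :
    Psi (box (tensor_sum ten s) (tensor_sum ten s')) g =
    Psi (tensor_sum ten s) g * Psi (tensor_sum ten s') g.
  rewrite /tensor_sum (bilinear_suml bbox) !Psi_sum mulr_suml; apply: eq_bigr => w _.
  rewrite (bilinear_sumr bbox) Psi_sum mulr_sumr; apply: eq_bigr => w' _.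
  exact: Psi_box_elementary.
have bd w w' : normc (Psi (box w w') g - Psi w g * Psi w' g) <= 2 * (rnorm w * rnorm w').
  rewrite (le_trans (normcB _ _))// mulr_natl mulr2n lerD//.
    exact: le_trans (Psi_bound _ _) (box1 _ _).
  by rewrite Normc.normcM ler_pM ?normc_ge0// Psi_bound.
apply/eqP; rewrite -subr_eq0; apply/eqP.
apply: (functional_eq0 (phi := fun v => Psi (box u v) g - Psi u g * Psi v g)
    (C := 2 * rnorm u)).
- by move=> w w'; rewrite (bilinearBr bbox) !PsiB; ring.
- by rewrite mulr_ge0// rnorm_ge0.
- by move=> w; rewrite -mulrA.
move=> s.
apply: (functional_eq0 (phi := fun u => Psi (box u (tensor_sum ten s)) g -
    Psi u g * Psi (tensor_sum ten s) g) (C := 2 * rnorm (tensor_sum ten s))).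
- by move=> w w'; rewrite (bilinearBl bbox) !PsiB; ring.
- by rewrite mulr_ge0// rnorm_ge0.
- by move=> w; rewrite -mulrA (mulrC (rnorm (tensor_sum _ _))).
- by move=> s'; rewrite Psi_box_sum subrr.
Qed.

End Multiplicativity.
(** * From trigonometric functions to indicators *)

Section TrigonometricClass.
Context (R : realType).
Local Notation TR := (measurableTypeR R).

Lemma bernoulli_ineq (y : R) n : -1 <= y -> 1 + n%:R * y <= (1 + y) ^+ n.
Proof.
move=> y1; elim: n => [|n ih]; first by rewrite mul0r addr0 expr0.
have y0 : 0 <= 1 + y by lra.
have n0 : 0 <= n%:R * (y * y) by rewrite mulr_ge0// -expr2 sqr_ge0.
rewrite exprS; apply: le_trans (ler_wpM2l y0 ih).
rewrite -natr1; nra.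
Qed.

Lemma cvg_natr_expr (r : R) : 0 <= r < 1 -> n%:R * r ^+ n @[n --> \oo] --> (0 : R).
Proof.
move=> /andP[r0 r1]; pose s := Num.sqrt r.
have s0 : 0 <= s := sqrtr_ge0 r.
have s1 : s < 1 by rewrite -[ltRHS](@sqrtr1 R) ltr_sqrt.
have rE : r = s ^+ 2 by rewrite sqr_sqrtr.
(* s ^ (- n) >= 1 + n (1 / s - 1) by Bernoulli, hence n s ^ n <= 1 / (1 - s) *)
have bd n : n%:R * s ^+ n * (1 - s) <= 1.
  have [->|sn0] := eqVneq s 0.
    by case: n => [|n]; rewrite ?mul0r// expr0n/= mulr0 mul0r.
  have sp : 0 < s by rewrite lt_neqAle eq_sym sn0.
  have si : 1 <= s^-1 by rewrite invf_ge1 ?ltW.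
  have h : 1 + n%:R * (s^-1 - 1) <= s^-1 ^+ n.
    by rewrite [leRHS](_ : _ = (1 + (s^-1 - 1)) ^+ n);
      [apply: bernoulli_ineq; lra|congr (_ ^+ _); ring].
  have sn : 0 <= s ^+ n by rewrite exprn_ge0.
  have := ler_wpM2l sn h; rewrite -exprMn mulfV// expr1n.
  have e : 1 - s = s * (s^-1 - 1) by rewrite mulrBr mulfV// mulr1.
  have : n%:R * s ^+ n * (1 - s) <= n%:R * s ^+ n * (s^-1 - 1).
    by rewrite ler_wpM2l ?mulr_ge0// e ler_piMl ?(ltW s1)// subr_ge0.
  by lra.
have s1' : 0 < 1 - s by rewrite subr_gt0.
apply: (@squeeze_cvg0 _ _ (fun n => (1 - s)^-1 * s ^+ n)).
  move=> n; rewrite mulr_ge0 ?exprn_ge0//= rE -exprM mulnC exprM expr2 mulrA.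
  by rewrite ler_wpM2r ?exprn_ge0// -[leRHS]mul1r ler_pdivlMr.
by apply: (@cvg_geometric R (1 - s)^-1 s); rewrite ger0_norm.
Qed.

(** The powers of 1 - z ^ n used in the elementary proofs of the
    Stone-Weierstrass theorem: they separate z < 1/2 from z >= 1/2. *)
Definition threshold (n : nat) (z : R) : R := (1 - z ^+ n) ^+ (n * 2 ^ n).

Lemma threshold_itv n (z : R) : 0 <= z <= 1 -> 0 <= threshold n z <= 1.
Proof.
move=> /andP[z0 z1]; have zn0 : 0 <= z ^+ n by rewrite exprn_ge0.
have zn1 : z ^+ n <= 1 by rewrite exprn_ile1.
by rewrite /threshold exprn_ge0 ?subr_ge0//= exprn_ile1// ?subr_ge0// gerBl.
Qed.

Lemma cvg_threshold (z : R) : 0 <= z <= 1 ->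
  threshold n z @[n --> \oo] --> ((z < 2^-1)%R%:R : R).
Proof.
move=> z01; have /andP[z0 z1] := z01.
have zn0 n : 0 <= z ^+ n by rewrite exprn_ge0.
have zn1 n : z ^+ n <= 1 by rewrite exprn_ile1.
case: ltP => zh.
- have z2 : 0 <= 2 * z < 1 by rewrite mulr_ge0//= mulrC -ltr_pdivlMr// div1r.
  have c := cvg_natr_expr z2.
  apply/subr_cvg0/norm_cvg0P; apply: squeeze_cvg0 c => n; rewrite normr_ge0/=.
  have /andP[_ t1] := threshold_itv n z01.
  rewrite distrC ger0_norm ?subr_ge0// lerBlDr -lerBlDl.
  have := @bernoulli_ineq (- z ^+ n) (n * 2 ^ n); rewrite lerN2 => /(_ (zn1 n)).
  by apply: le_trans; rewrite natrM natrX exprMn mulrN mulrA.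
- have c : (n.+1%:R^-1 : R) @[n --> \oo] --> (0 : R) by exact: cvg_harmonic.
  apply: squeeze_cvg0 c => n.
  have /andP[-> _] := threshold_itv n z01; rewrite /=.
  rewrite -[leRHS]mul1r ler_pdivlMr//.
  have b : n.+1%:R <= (1 + z ^+ n) ^+ (n * 2 ^ n).
    have h := @bernoulli_ineq (z ^+ n) (n * 2 ^ n) _.
    apply: le_trans (h _); last by apply: le_trans (zn0 n); lra.
    rewrite -natr1 addrC lerD2l natrM natrX -mulrA -exprMn.
    rewrite ler_peMr// exprn_ege1// -ler_pdivrMl// mulr1//.
  apply: (@le_trans _ _ (threshold n z * (1 + z ^+ n) ^+ (n * 2 ^ n))).
    by rewrite ler_wpM2l// /threshold exprn_ge0// subr_ge0.
  rewrite /threshold -exprMn -subr_sqr expr1n exprn_ile1//.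
    by rewrite subr_ge0 exprn_ile1// exprn_ile1.
  by rewrite gerBl sqr_ge0.
Qed.

(** At low frequency a square wave that jumps at x looks like a half-line. *)
Lemma cvg_wave (x t : R) : \forall m \near \oo,
  ((1 + sin (m.+1%:R^-1 * (t - x))) / 2 < 2^-1) = (t < x).
Proof.
have pi0 := pi_gt0 R.
have /archi_boundP := divr_ge0 (normr_ge0 (t - x)) (ltW pi0).
set k := Num.bound _ => kb.
exists k => // m /= km.
have m0 : (0 : R) < m.+1%:R^-1 by rewrite invr_gt0.
have lt_pi : m.+1%:R^-1 * `|t - x| < pi.
  rewrite mulrC ltr_pdivrMr// mulrC -ltr_pdivrMr//.
  by apply: lt_le_trans kb _; rewrite ler_nat leqW.
have -> : ((1 + sin (m.+1%:R^-1 * (t - x))) / 2 < 2^-1) = (sin (m.+1%:R^-1 * (t - x)) < 0).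
  by rewrite -[X in _ < X]mul1r ltr_pM2r ?invr_gt0// gtrDl.
have [tx|tx] := ltP t x.
  rewrite -[_ * _]opprK sinN oppr_lt0 sin_gt0_pi// -mulrN opprB mulr_gt0 ?subr_gt0//=.
  by move: lt_pi; rewrite ler0_norm ?opprB// subr_le0 ltW.
apply/negbTE; rewrite -leNgt; apply: sin_ge0_pi.
rewrite mulr_ge0 ?subr_ge0 ?(ltW m0)//=.
by move: lt_pi; rewrite ger0_norm ?subr_ge0// => /ltW.
Qed.

Variable H : set (TR -> R[i]).
Hypothesis H1 : H (fun=> 1).
Hypothesis Hlin : forall c w w', H w -> H w' -> H (fun t => c * w t + w' t).
Hypothesis Hcis : forall c w, H w -> H (fun t => cis (c * t) * w t).
Hypothesis Hlim : forall (M : R) (w_ : nat -> TR -> R[i]) w,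
  (forall n, H (w_ n)) -> (forall n t, normc (w_ n t) <= M) ->
  (forall t, normc (w_ n t - w t) @[n --> \oo] --> (0 : R)) -> H w.

Let H_ext w w' : w =1 w' -> H w -> H w'.
Proof. by move=> /funext ->. Qed.

Let H0 : H (fun=> 0).
Proof. by apply: H_ext (Hlin (-1) H1 H1) => t; rewrite mulN1r addNr. Qed.

Let HZ c w : H w -> H (fun t => c * w t).
Proof. by move=> Hw; apply: H_ext (Hlin c Hw H0) => t; rewrite addr0. Qed.

Let wave (c x t : R) : R := (1 + sin (c * (t - x))) / 2.

Let wave_itv c x t : 0 <= wave c x t <= 1.
Proof.
have := sin_geN1 (c * (t - x)); have := sin_le1 (c * (t - x)); rewrite /wave; lra.
Qed.

Let H_wave c x w : H w -> H (fun t => (wave c x t)%:C * w t).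
Proof.
move=> Hw.
(* (1 + sin y) / 2 = 1/2 - (i/4) cis y + (i/4) cis (- y) *)
have := Hlin ((- 4^-1) *i * cis (- (c * x))) (Hcis c Hw)
  (Hlin (4^-1 *i * cis (c * x)) (Hcis (- c) Hw) (HZ (2^-1)%:C Hw)).
apply: H_ext => t.
rewrite !mulrA -!mulrDl -!(mulrA _ (cis _) (cis _)) -!cisD; congr (_ * _).
have -> : - (c * x) + c * t = c * (t - x) by ring.
have -> : c * x + - c * t = - (c * (t - x)) by ring.
by apply/eqP; rewrite eq_complex /cis cosN sinN /wave/=; apply/andP; split; apply/eqP; field.
Qed.

Let H_thresholdM c x n N w :
  H w -> H (fun t => ((1 - wave c x t ^+ n) ^+ N)%:C * w t).
Proof.
have HX k w' : H w' -> H (fun t => (wave c x t ^+ k)%:C * w' t).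
  move=> Hw'; elim: k => [|k ih]; first by apply: H_ext Hw' => t; rewrite expr0 mul1r.
  apply: H_ext (H_wave c x ih) => t; rewrite exprS mulrA; congr (_ * _).
  by rewrite -rmorphM.
move=> Hw; elim: N => [|N ih]; first by apply: H_ext Hw => t; rewrite expr0 mul1r.
apply: H_ext (Hlin (-1) (HX n _ ih) ih) => t.
rewrite exprS [in RHS]rmorphM/= rmorphB/= rmorph1; ring.
Qed.

Let H_square c x : H (fun t => ((wave c x t < 2^-1)%R%:R : R)%:C).
Proof.
apply: (Hlim (M := 1) (w_ := fun n t => (threshold n (wave c x t))%:C)).
- by move=> n; apply: H_ext (H_thresholdM c x n (n * 2 ^ n) H1) => t; rewrite mulr1.
- move=> n t; rewrite normc_real.
  by have /andP[t0 t1] := threshold_itv n (wave_itv c x t); rewrite ger0_norm.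
- move=> t; under eq_fun do rewrite -rmorphB normc_real.
  by apply/norm_cvg0P/subr_cvg0; exact: cvg_threshold (wave_itv c x t).
Qed.

Let H_half x : H (fun t => ((t < x)%R%:R : R)%:C).
Proof.
apply: (Hlim (M := 1) (w_ := fun m t => ((wave m.+1%:R^-1 x t < 2^-1)%R%:R : R)%:C)).
- by move=> n; exact: H_square.
- by move=> n t; rewrite normc_real; case: (_ < _); rewrite ?normr1 ?normr0.
- move=> t; apply: (cvg_near_cst (0 : R)).
  apply: filterS (cvg_wave x t) => m e.
  by rewrite /wave e subrr Normc.normc0.
Qed.

(** The class contains the trigonometric polynomials, hence square waves,
    hence indicators of half-lines, hence those of all Borel sets by the
    pi-lambda theorem. This replaces the uniqueness theorem for Fourier
    transforms of integrable functions. *)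
Lemma trigonometric_class (B : set TR) : measurable B -> H (fun t => (\1_B t : R[i])).
Proof.
move=> mB.
have e : @measurable _ TR = <<s @RGenInftyO.G R >>.
  by have := RGenInftyO.measurableE R.
apply: (dynkin_induction e (P := fun B => H (fun t => (\1_B t : R[i])))).
- move=> _ _ [x ->] [y ->]; exists (Num.min x y).
  by apply/seteqP; split => t /=; rewrite !in_itv/= lt_min;
    [by move=> [-> ->]|by move=> /andP].
- by move=> /=; apply: H_ext H1 => t; rewrite indicT.
- move=> _ [x ->] /=; apply: H_ext (H_half x) => t.
  by rewrite indicE mem_setE/= in_itv/=; case: (_ < _).
- move=> S _ HS /=; apply: H_ext (Hlin (-1) HS H1) => t.
  by rewrite !indicE in_setC; case: (t \in S); rewrite /= ?mulr0 ?add0r ?mulr1 ?addNr.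
- move=> F mF tF HF.
  apply: (Hlim (M := 1) (w_ := fun n t => (\1_(\bigcup_(k < n) F k) t : R[i]))).
  + elim=> [|n ih].
      by apply: H_ext H0 => t; rewrite bigcup_mkord big_ord0 indic0.
    apply: H_ext (Hlin 1 (HF n) ih) => t; rewrite mul1r.
    rewrite !bigcup_mkord big_ord_recr/= -!bigcup_mkord !indicE in_setU.
    case: (boolP (t \in F n)) => tn; case: (boolP (t \in \bigcup_(k < n) F k)) => // tU;
      rewrite ?addr0 ?add0r//.
    move: tU; rewrite inE => -[k /= kn Fk]; move: tn; rewrite inE => Fn.
    have kE : k = n by apply: tF => //; exists t.
    by rewrite kE ltnn in kn.
  + by move=> n t; rewrite indicE; case: (_ \in _); rewrite ?Normc.normc1 ?Normc.normc0.
  + move=> t; apply: (cvg_near_cst (0 : R)).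
    have [[k _ Fk]|nF] := pselect ((\bigcup_k F k) t).
      exists k.+1 => // n /= kn; rewrite !indicE !mem_set ?subrr ?Normc.normc0//.
      * by exists k.
      * by exists k.
    apply: nearW => n; rewrite !indicE !memNset ?subrr ?Normc.normc0//.
    by move=> [k _ Fk]; apply: nF; exists k.
- by rewrite -e.
Qed.

End TrigonometricClass.
(** * Functionals vanishing on the kernel of Psi *)

Section VanishingCoefficients.
Context (R : realType) (p q : R) (p1 : 1 <= p) (q1 : 1 <= q).
Hypothesis pq : p^-1 + q^-1 = 1.
Local Notation TR := (measurableTypeR R).
Local Notation mu := (@haar R).
Local Notation X := (LpRx p1).
Local Notation Y := (LpRx q1).
Context (A : completeNormedModType R[i]) (ten : X -> Y -> A).
Context (Psi : A -> affine R -> R[i]).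
Hypotheses (Aten : is_projective_tensor ten) (APsi : is_Psi ten Psi).
Context (u : A).
Hypothesis Psiu : Psi u = fun=> 0.

Let vanishing (b : X -> Y -> R[i]) M := vanishes_at ten (b : X -> Y -> R[i]^o) M u.

Let normc_cisM (b M : R) (w : TR -> R[i]) : (forall t, normc (w t) <= M) ->
  forall t, normc (cis (b * t) * w t) <= M.
Proof. by move=> wM t; rewrite Normc.normcM normc_cis mul1r. Qed.

Let meas_cisM (b : R) (w : TR -> R[i]) :
  cmeasurable w -> cmeasurable (fun t : TR => cis (b * t) * w t).
Proof. by move=> mw; apply: cmeasurableM => //; exact: cmeasurable_cis. Qed.

(** The vanishing of Psi u on the fibre over a says that the extension to u of
    the coefficient functionals kills all modulations. *)
Lemma vanishing_cis (a b : R) : a != 0 ->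
  vanishing (coef a (fun t : TR => cis (b * t))) 1.
Proof.
move=> a0 s; rewrite mul1r.
pose g : affine R := mk_affine (b / (2 * pi)) a0.
have pi2 : 2 * pi != 0 :> R by rewrite mulf_neq0// gt_eqF// pi_gt0.
have gb : 2 * pi * g.1 = b by rewrite /= mulrC divfK.
rewrite rnorm_scalar (_ : tensor_sum _ s = Psi (tensor_sum ten s - u) g); last first.
  rewrite (PsiB APsi) Psiu subr0 /tensor_sum (Psi_sum APsi); apply: eq_bigr => w _.
  by rewrite (PsiE APsi) gb.
exact: (Psi_bound APsi).
Qed.

(** The weights for which the coefficient functional and all its modulations
    vanish at u form a class as in [trigonometric_class]; the bounded limits are
    those of dominated convergence. *)
Lemma vanishing_indic (a : R) (B : set TR) : a != 0 -> measurable B ->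
  vanishing (coef a (fun t : TR => (\1_B t : R[i]))) 1.
Proof.
move=> a0 mB.
pose H : set (TR -> R[i]) := [set w | exists2 M : R, (forall t, normc (w t) <= M) &
  cmeasurable w /\ forall b, vanishing (coef a (fun t : TR => cis (b * t) * w t)) M].
have bil w (M : R) (mw : cmeasurable w) (wM : forall t, normc (w t) <= M) :
  bilinear_map (coef a w : X -> Y -> R[i]^o) := coef_bilinear p1 q1 pq a0 mw wM.
have bnd w (M : R) : cmeasurable w -> (forall t, normc (w t) <= M) -> forall (x : X) (y : Y),
    rnorm (coef a w x y : R[i]^o) <= M * (rnorm x * rnorm y).
  by move=> mw wM x y; exact: (coef_bound pq).
have ext w w' (M : R) : w =1 w' -> vanishing (coef a w) M -> vanishing (coef a w') M.
  by move=> /funext ->.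
suff [M _ [_ /(_ 0) v]] : H (fun t => (\1_B t : R[i])).
  have mI := cmeasurable_indic R mB.
  have I1 (t : TR) : normc (\1_B t : R[i]) <= 1.
    by rewrite indicE; case: (_ \in _); rewrite ?Normc.normc1 ?Normc.normc0.
  apply: (vanishes_sharpen Aten (M0 := M) (bil _ _ mI I1) _ (bnd _ _ mI I1)) => //.
  by apply: ext v => t; rewrite mul0r cis0 mul1r.
apply: trigonometric_class => //.
- exists 1; first by move=> t; rewrite Normc.normc1.
  split; first exact: cmeasurable_cst.
  by move=> b; apply: ext (vanishing_cis b a0) => t; rewrite mulr1.
- move=> c w w' [M wM [mw v]] [M' wM' [mw' v']].
  have cM t : normc (c * w t + w' t) <= normc c * M + M'.
    by rewrite (le_trans (normcD _ _))// lerD// Normc.normcM ler_wpM2l// normc_ge0.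
  have mcw : cmeasurable (fun t => c * w t + w' t).
    by apply: cmeasurableD => //; exact: cmeasurableZ.
  rewrite /H/=; exists (normc c * M + M'); first exact: cM.
  split => // b s.
  have := vanishes_lin (Z := R[i]^o) c (v b) (v' b) s.
  rewrite (_ : (fun _ _ => _) = (coef a (fun t : TR => cis (b * t) * (c * w t + w' t))
      : X -> Y -> R[i]^o))//.
  apply/funext => x; apply/funext => y.
  have c1 := coef_cintegrable pq x y a0 (meas_cisM b mw) (normc_cisM b wM).
  have c2 := coef_cintegrable pq x y a0 (meas_cisM b mw') (normc_cisM b wM').
  rewrite /coef -[c *: _]/(c * _) -cintegralZ// -cintegralD//; last exact: cintegrableZ.
  by apply: eq_cintegral => t; ring.
- move=> c w [M wM [mw v]]; exists M; first exact: normc_cisM.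
  split; first exact: meas_cisM.
  by move=> b; apply: ext (v (b + c)) => t; rewrite mulrDl cisD mulrA.
- move=> M w_ w Hw wM cw.
  have mw_ n : cmeasurable (w_ n) by case: (Hw n) => ? _ [].
  have mw : cmeasurable w by exact: cmeasurable_cvg cw.
  have wM' t : normc (w t) <= M.
    apply/ler_addgt0Pl => e e0; move/cvgrPdist_lt : (cw t) => /(_ _ e0)[n _ /(_ n (leqnn n))].
    rewrite sub0r normrN ger0_norm ?normc_ge0// => h.
    by rewrite -[w t](subKr (w_ n t)) (le_trans (normcB _ _))// addrC lerD// ltW.
  exists M => //; split => // b.
  apply: (vanishes_cvg (Z := R[i]^o)
    (b_ := fun n => coef a (fun t : TR => cis (b * t) * w_ n t))).
    move=> n; have [M0 _ [_ /(_ b) v]] := Hw n.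
    have M_ge0 : 0 <= M := le_trans (normc_ge0 _) (wM n 0).
    have m := meas_cisM b (mw_ n); have k := normc_cisM b (wM n).
    exact: (vanishes_sharpen Aten (bil _ _ m k) M_ge0 (bnd _ _ m k) v).
  move=> x y; rewrite /coef.
  have c := coef_cintegrable1 pq x y a0.
  have iG : mu.-integrable setT
      (EFin \o (fun t : TR => M * normc (Lp_repr x (t * a) * Lp_repr y t))).
    have := integrableZl measurableT M (cintegrable_norm c).
    by apply: eq_integrable => // t _; rewrite /= EFinM.
  have [] // := cintegral_dominated
    (f_ := fun n (t : TR) => cis (b * t) * w_ n t * Lp_repr x (t * a) * Lp_repr y t)
    (f := fun t : TR => cis (b * t) * w t * Lp_repr x (t * a) * Lp_repr y t) _ iG.
  + by move=> n; case: (coef_cintegrable pq x y a0 (meas_cisM b (mw_ n)) (normc_cisM b (wM n))).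
  + move=> n t; rewrite -mulrA Normc.normcM ler_wpM2r ?normc_ge0//.
    exact: (normc_cisM b (wM n)).
  + move=> t.
    pose K := cis (b * t) * Lp_repr x (t * a) * Lp_repr y t.
    have := cvgM (cw t) (cvg_cst (normc K)); rewrite mul0r => h.
    apply: (@squeeze_cvg0 _ _ (fun n => normc (w_ n t - w t) * normc K)); last exact: h.
    move=> n.
    rewrite normc_ge0/= -Normc.normcM le_eqVlt; apply/orP; left; apply/eqP.
    by congr (Normc.normc _); rewrite /K; ring.
Qed.

End VanishingCoefficients.
Section Indicators.
Context d (T : measurableType d) (R : realType).
Variable mu : {measure set T -> \bar R}.

Lemma normc_indic (B : set T) t : normc (\1_B t : R[i]) = \1_B t.
Proof. by rewrite !indicE; case: (t \in B); rewrite ?Normc.normc1 ?Normc.normc0. Qed.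

Lemma cLnorm_indic (r : R) (B : set T) : 0 < r -> measurable B ->
  cLnorm mu r (fun t => (\1_B t : R[i])) = (mu B `^ r^-1)%E.
Proof.
move=> r0 mB; rewrite cLnormE; congr (_ `^ _)%E.
rewrite -[in RHS](setIT B) -integral_indic//; apply: eq_integral => t _.
by rewrite normc_indic indicE; case: (t \in B); rewrite ?powR1// powR0// gt_eqF.
Qed.

Lemma cLnorm_mono (p : R) (f g : T -> R[i]) : 1 <= p -> cmeasurable f -> cmeasurable g ->
  (forall t, normc (f t) <= normc (g t)) -> (cLnorm mu p f <= cLnorm mu p g)%E.
Proof.
move=> p1 mf mg fg.
exact: (@cLnorm_le _ _ _ mu p p1 f (fun t => normc (g t)) mf (measurable_normc mg) fg).
Qed.

Lemma cintegrable_local (p q : R) (p1 : 1 <= p) (B : set T) (x : Lp mu p1) :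
  0 < q -> p^-1 + q^-1 = 1 -> measurable B -> (mu B < +oo)%E ->
  cintegrable mu (fun t => (\1_B t : R[i]) * Lp_repr x t).
Proof.
move=> q0 pq mB Boo; have p0 : 0 < p by exact: (lt_le_trans ltr01 p1).
have mI := cmeasurable_indic R mB.
split; first by apply: cmeasurableM => //; exact: Lp_meas.
apply: le_lt_trans (cintegral_hoelder _ q0 p0 _ mI (Lp_meas x)) _.
  by rewrite addrC.
rewrite cLnorm_indic// -rnorm_Lp lte_mul_pinfty ?poweR_ge0// ?ltry//.
by rewrite ge0_fin_numE ?poweR_ge0// poweR_lty.
Qed.

Definition local_integral (p : R) (p1 : 1 <= p) (B : set T) (x : Lp mu p1) : R[i] :=
  cintegral mu (fun t => (\1_B t : R[i]) * Lp_repr x t).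

Lemma local_integral_linear (p q : R) (p1 : 1 <= p) (B : set T) a (x y : Lp mu p1) :
  0 < q -> p^-1 + q^-1 = 1 -> measurable B -> (mu B < +oo)%E ->
  local_integral B (a *: x + y) = a * local_integral B x + local_integral B y.
Proof.
move=> q0 pq mB Boo; have int (z : Lp mu p1) := cintegrable_local z q0 pq mB Boo.
have mm (z : Lp mu p1) : cmeasurable (fun t => (\1_B t : R[i]) * Lp_repr z t) by case: (int z).
rewrite /local_integral -cintegralZ// -cintegralD//; last exact: cintegrableZ.
apply: cintegral_ae_eq => //; first by apply: cmeasurableD => //; exact: cmeasurableZ.
apply: ae_imply (Lp_repr_lin a x y) => t -> _; ring.
Qed.

End Indicators.

Section VanishingProducts.
Context (R : realType) (p q : R) (p1 : 1 <= p) (q1 : 1 <= q).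
Hypothesis pq : p^-1 + q^-1 = 1.
Local Notation TR := (measurableTypeR R).
Local Notation mu := (@haar R).
Local Notation X := (LpRx p1).
Local Notation Y := (LpRx q1).
Context (A : completeNormedModType R[i]) (ten : X -> Y -> A).
Context (Psi : A -> affine R -> R[i]).
Hypotheses (Aten : is_projective_tensor ten) (APsi : is_Psi ten Psi).
Context (u : A).
Hypothesis Psiu : Psi u = fun=> 0.

Let p0 : 0 < p. Proof. exact: lt_le_trans p1. Qed.
Let q0 : 0 < q. Proof. exact: lt_le_trans q1. Qed.
Let qp : q^-1 + p^-1 = 1. Proof. by rewrite addrC. Qed.

(** Averaging the coefficient functionals of the sets J /\ h^-1 I over h gives
    the product of the integrals over I and J; only ratios h of points of I
    and J contribute, and these form a set of finite measure. *)
Lemma vanishing_product n (I J : set TR) : measurable I -> measurable J ->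
  I `<=` annulus n -> J `<=` annulus n ->
  exists M, vanishes_at ten
    (fun (x : X) (y : Y) => local_integral I x * local_integral J y : R[i]^o) M u.
Proof.
move=> mI mJ In Jn.
have Ioo := sub_annulus_fin mI In; have Joo := sub_annulus_fin mJ Jn.
set N := (n.+1 * n.+1)%N; exists (fine (mu (annulus N))) => s.
pose f (w : X * Y) (t : TR) := (\1_I t : R[i]) * Lp_repr w.1 t.
pose g (w : X * Y) (t : TR) := (\1_J t : R[i]) * Lp_repr w.2 t.
have cf w : cintegrable mu (f w) := cintegrable_local w.1 q0 pq mI Ioo.
have cg w : cintegrable mu (g w) := cintegrable_local w.2 p0 qp mJ Joo.
pose k w (h : TR) := cintegral mu (fun t => f w (h * t) * g w t).
have ck w : cintegrable mu (k w) by have [] := cintegral_mconv (cf w) (cg w).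
have ke w : cintegral mu (k w) = local_integral I w.1 * local_integral J w.2.
  by have [] := cintegral_mconv (cf w) (cg w).
pose D (h : TR) : set TR := J `&` (fun t => t * h) @^-1` I.
have mD h : measurable (D h).
  apply: measurableI => //; rewrite -[X in measurable X]setTI.
  exact: (measurable_mulr h).
have kE w h : k w h = coef h (fun t : TR => (\1_(D h) t : R[i])) w.1 w.2.
  apply: eq_cintegral => t; rewrite /f /g (mulrC h t).
  have -> : (\1_(D h) t : R[i]) = \1_I (t * h)%R * \1_J t.
    by rewrite !indicE in_setI mulrC -natrM mulnb; congr (_ && _)%:R.
  ring.
have [c e] := cintegral_sum s ck.
rewrite rnorm_scalar /tensor_sum.
rewrite (eq_bigr (fun w => cintegral mu (k w))); last by move=> w _; rewrite ke.
rewrite -e; apply: le_trans (normc_cintegral c) _.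
set r := rnorm _; have r0 : 0 <= r by exact: rnorm_ge0.
have mN := @measurable_annulus R N; have Noo := @haar_annulus R N.
rewrite -lee_fin [leLHS]fineK; last first.
  rewrite ge0_fin_numE; first by case: c.
  by apply: integral_ge0 => t _; rewrite lee_fin normc_ge0.
rewrite mulrC EFinM fineK ?ge0_fin_numE//.
have -> : mu (annulus N) = (\int[mu]_t (\1_(annulus N) t)%:E)%E.
  by rewrite integral_indic// setIT.
rewrite -ge0_integralZl//; last exact/measurable_EFinP/measurable_indic.
apply: ae_ge0_le_integral => //.
- by move=> t _; rewrite lee_fin normc_ge0.
- by apply/measurable_EFinP/measurable_normc; case: c.
- by move=> t _; rewrite -EFinM lee_fin mulr_ge0.
- apply/measurable_EFinP/measurable_funM => //; exact: measurable_indic.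
apply: ae_imply (@ae_neq0 R) => h h0 _; rewrite -EFinM lee_fin.
rewrite [X in _ * X]indicE; have [hN|hN] := boolP (h \in annulus N).
  rewrite mulr1 (eq_bigr (fun w => coef h (fun t : TR => (\1_(D h) t : R[i])) w.1 w.2)).
    have := vanishing_indic pq Aten APsi Psiu h0 (mD h) s.
    by rewrite mul1r.
  by move=> w _; rewrite kE.
rewrite mulr0 big1 ?Normc.normc0// => w _; rewrite kE -[RHS](cintegral0 mu).
apply: cintegral_ae_eq.
- apply: cmeasurableM; last exact: Lp_meas.
  apply: cmeasurableM; first exact: cmeasurable_indic.
  by apply: cmeasurable_scale; exact: Lp_meas.
- exact: cmeasurable_cst.
apply: ae_imply (@ae_neq0 R) => t t0 _.
rewrite indicE memNset ?mul0r// => -[Jt It]; move/negP: hN; apply; apply/mem_set.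
by apply: annulus_ratio t0 (Jn _ Jt) _; rewrite mulrC; exact: In.
Qed.

End VanishingProducts.
(** * Conditional expectations *)

Section ConditionalExpectation.
Context d (T : measurableType d) (R : realType).
Variable mu : {measure set T -> \bar R}.
Context (p q : R) (p1 : 1 <= p).
Hypotheses (q0 : 0 < q) (pq : p^-1 + q^-1 = 1).
Local Notation X := (Lp mu p1).

Let p0 : 0 < p. Proof. exact: lt_le_trans p1. Qed.

Definition chi (B : set T) : X := Lp_of mu p1 (fun t => (\1_B t : R[i])).

Lemma chi_repr (B : set T) : measurable B -> (mu B < +oo)%E ->
  {ae mu, forall t, Lp_repr (chi B) t = \1_B t}.
Proof.
move=> mB Boo; apply: Lp_of_repr; first exact: cmeasurable_indic.
by rewrite cLnorm_indic// poweR_lty.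
Qed.

Lemma Lp_repr_sum I (s : seq I) (a : I -> R[i]) (z : I -> X) :
  {ae mu, forall t,
    Lp_repr (\sum_(i <- s) a i *: z i) t = \sum_(i <- s) a i * Lp_repr (z i) t}.
Proof.
elim: s => [|i s ih].
  apply: ae_imply (Lp_repr_lin (-1) 0 (0 : X)) => t.
  by rewrite scaler0 addr0 mulN1r addNr !big_nil.
apply: ae_imply (filterI (Lp_repr_lin (a i) (z i) (\sum_(i <- s) a i *: z i)) ih).
by move=> t [h1 h2]; rewrite !big_cons h1 h2.
Qed.

Variables (K : finType) (E : K -> set T).
Hypothesis mE : forall k, measurable (E k).
Hypothesis Eoo : forall k, (mu (E k) < +oo)%E.
Hypothesis tE : trivIset setT E.

Let v k := fine (mu (E k)).
Let v_ge0 k : 0 <= v k. Proof. by rewrite fine_ge0. Qed.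
Let vE k : mu (E k) = (v k)%:E.
Proof. by rewrite fineK// ge0_fin_numE. Qed.

(** The mean over a null set is 0, since 0^-1 = 0. *)
Definition mean (k : K) (x : X) : R[i] := ((fine (mu (E k)))^-1)%:C * local_integral (E k) x.

(** The conditional expectation with respect to a finite family of disjoint
    sets of finite measure, zero outside their union. *)
Definition cond_exp (x : X) : X := \sum_k mean k x *: chi (E k).

Lemma mean_linear k a x y : mean k (a *: x + y) = a * mean k x + mean k y.
Proof. by rewrite /mean (local_integral_linear a x y q0 pq)//; ring. Qed.

Lemma cond_exp_linear a x y : cond_exp (a *: x + y) = a *: cond_exp x + cond_exp y.
Proof.
rewrite /cond_exp scaler_sumr -big_split/=; apply: eq_bigr => k _.
by rewrite mean_linear scalerDl scalerA.
Qed.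

Lemma cond_exp_repr x :
  {ae mu, forall t, Lp_repr (cond_exp x) t = \sum_k mean k x * \1_(E k) t}.
Proof.
have h := Lp_repr_sum (index_enum K) (fun k => mean k x) (fun k => chi (E k)).
have h' : {ae mu, forall t, forall k, Lp_repr (chi (E k)) t = \1_(E k) t}.
  by apply: filter_forall => k; exact: chi_repr.
near=> t; rewrite (near h t)//; apply: eq_bigr => k _.
by rewrite (near h' t).
Unshelve. all: by end_near. Qed.

Lemma sum_indic_in (S : pzRingType) (F : K -> S) t k : E k t ->
  \sum_j F j * \1_(E j) t = F k.
Proof.
move=> Ek; rewrite (bigD1 k)//= indicE mem_set// mulr1 big1 ?addr0// => j jk.
rewrite indicE memNset ?mulr0// => Ej; move/eqP: jk; apply.
by apply: tE => //; exists t.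
Qed.

Lemma sum_indic_out (S : pzRingType) (F : K -> S) t : (forall k, ~ E k t) ->
  \sum_j F j * \1_(E j) t = 0.
Proof. by move=> nE; rewrite big1// => j _; rewrite indicE memNset ?mulr0. Qed.

(** Jensen's inequality on one set, by Hoelder. *)
Lemma mean_le k x :
  ((normc (mean k x) `^ p)%:E * mu (E k) <=
   \int[mu]_t ((\1_(E k) t : R) * normc (Lp_repr x t) `^ p)%:E)%E.
Proof.
set S := (\int[mu]_t _)%E.
have S0 : (0 <= S)%E by apply: integral_ge0 => t _; rewrite lee_fin mulr_ge0// powR_ge0.
have mI := cmeasurable_indic R (mE k).
pose f t := (\1_(E k) t : R[i]) * Lp_repr x t.
have mf : cmeasurable f by apply: cmeasurableM => //; exact: Lp_meas.
have Sf : cLnorm mu p f = (S `^ p^-1)%E.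
  rewrite cLnormE; congr (_ `^ _)%E; apply: eq_integral => t _.
  rewrite /f Normc.normcM normc_indic !indicE; case: (t \in _); rewrite ?mul1r//.
  by rewrite !mul0r powR0 ?gt_eqF.
have [v0|v0] := eqVneq (v k) 0; first by rewrite vE v0 mule0.
have vp : 0 < v k by rewrite lt_neqAle eq_sym v0 v_ge0.
have [->|Soo] := eqVneq S +oo%E; first by rewrite leey.
have Sfin : S \is a fin_num by rewrite ge0_fin_numE// lt_neqAle Soo leey.
have SE : S = (fine S)%:E by rewrite fineK.
have s0 : 0 <= fine S by rewrite fine_ge0.
have hol : normc (local_integral (E k) x) <= v k `^ q^-1 * fine S `^ p^-1.
  apply: le_trans (normc_cintegral (cintegrable_local x q0 pq (mE k) (Eoo k))) _.
  rewrite -lee_fin fineK; last first.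
    rewrite ge0_fin_numE; first by case: (cintegrable_local x q0 pq (mE k) (Eoo k)).
    by apply: integral_ge0 => t _; rewrite lee_fin normc_ge0.
  have qp : q^-1 + p^-1 = 1 by rewrite addrC.
  have := cintegral_hoelder mu q0 p0 qp mI mf.
  rewrite cLnorm_indic// Sf vE SE !poweR_EFin -EFinM; apply: le_trans.
  rewrite le_eqVlt; apply/orP; left; apply/eqP; apply: eq_integral => t _.
  by rewrite /f mulrA -[in RHS](_ : (\1_(E k) t : R[i]) = \1_(E k) t * \1_(E k) t)//
    !indicE -natrM mulnb andbb.
have hm : normc (mean k x) <= v k `^ (- p^-1) * fine S `^ p^-1.
  rewrite /mean Normc.normcM normc_real ger0_norm ?invr_ge0//.
  apply: le_trans (ler_wpM2l _ hol) _; first by rewrite invr_ge0.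
  rewrite mulrA -[(v k)^-1]powR_inv1// -powRD; last by rewrite v0 implybT.
  have -> // : -1 + q^-1 = - p^-1 by rewrite -[X in - X + _]pq opprD subrK.
rewrite vE SE -EFinM lee_fin.
have : normc (mean k x) `^ p <= (v k `^ (- p^-1) * fine S `^ p^-1) `^ p.
  by rewrite ge0_ler_powR// ?nnegrE ?normc_ge0 ?mulr_ge0 ?powR_ge0// ltW.
rewrite powRM ?powR_ge0// -!powRrM mulNr mulVf ?gt_eqF// powRr1//.
move=> h; apply: le_trans (ler_wpM2r (ltW vp) h) _.
by rewrite powR_inv1// mulrAC mulVf// mul1r.
Qed.

(** The p-th power of the norm is the sum over k of the terms bounded in
    [mean_le], because the E k are disjoint. *)
Lemma cond_exp_contraction x : rnorm (cond_exp x) <= rnorm x.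
Proof.
pose g (t : T) : R := normc (Lp_repr x t) `^ p.
pose c k : R := normc (mean k x) `^ p.
have g0 t : 0 <= g t by exact: powR_ge0.
have c0 k : 0 <= c k by exact: powR_ge0.
have mg : measurable_fun setT g.
  by apply: (measurableT_comp (measurable_powR _)); exact/measurable_normc/Lp_meas.
have mI k : measurable_fun setT (\1_(E k) : T -> R) by exact: measurable_indic.
have mcI k : measurable_fun setT (fun t => (c k * \1_(E k) t)%:E).
  by apply/measurable_EFinP/measurable_funM; first exact: measurable_cst.
have mgI k : measurable_fun setT (fun t => (g t * \1_(E k) t)%:E).
  exact/measurable_EFinP/measurable_funM.
suff le : (\int[mu]_t (normc (Lp_repr (cond_exp x) t) `^ p)%:E <= \int[mu]_t (g t)%:E)%E.
  rewrite -lee_fin !rnorm_Lp !cLnormE; apply: gt0_ler_poweR le.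
  - by rewrite invr_ge0 ltW.
  - by rewrite in_itv/= leey andbT; apply: integral_ge0 => t _; rewrite lee_fin powR_ge0.
  - by rewrite in_itv/= leey andbT; apply: integral_ge0 => t _; rewrite lee_fin g0.
have -> : (\int[mu]_t (normc (Lp_repr (cond_exp x) t) `^ p)%:E =
    \int[mu]_t (\sum_k (c k * \1_(E k) t)%:E))%E.
  apply: ge0_ae_eq_integral => //.
  - apply/measurable_EFinP; apply: (measurableT_comp (measurable_powR _)).
    exact/measurable_normc/Lp_meas.
  - exact: emeasurable_sum.
  - by move=> t _; rewrite lee_fin powR_ge0.
  - by move=> t _; apply: sume_ge0 => k _; rewrite lee_fin mulr_ge0.
  apply: ae_imply (cond_exp_repr x) => t -> _; rewrite sumEFin; congr EFin.
  have [[k Ek]|nE] := pselect (exists k, E k t); first by rewrite !(sum_indic_in _ Ek).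
  rewrite !sum_indic_out ?Normc.normc0 ?powR0 ?gt_eqF// => k Ek; apply: nE; by exists k.
rewrite ge0_integral_sum//; last by move=> k t _; rewrite lee_fin mulr_ge0.
apply: (@le_trans _ _ (\sum_k \int[mu]_t (g t * \1_(E k) t)%:E)%E).
  apply: lee_sum => k _; under eq_integral do rewrite EFinM.
  rewrite ge0_integralZl//; last 2 first.
  - exact/measurable_EFinP.
  - by rewrite lee_fin.
  rewrite integral_indic// setIT; apply: le_trans (mean_le k x) _.
  by under eq_integral do rewrite mulrC.
rewrite -ge0_integral_sum//; last by move=> k t _; rewrite lee_fin mulr_ge0.
apply: ge0_le_integral => //.
- by move=> t _; apply: sume_ge0 => k _; rewrite lee_fin mulr_ge0.
- exact: emeasurable_sum.
- exact/measurable_EFinP.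
move=> t _; rewrite sumEFin lee_fin.
have [[k Ek]|nE] := pselect (exists k, E k t); first by rewrite (sum_indic_in _ Ek).
by rewrite sum_indic_out// => k Ek; apply: nE; exists k.
Qed.

Lemma chi_null (B : set T) : measurable B -> mu B = 0%E -> chi B = 0.
Proof.
move=> mB B0; apply: rnorm_eq0; apply: EFin_inj.
rewrite rnorm_Lp_of; [|exact: cmeasurable_indic|].
  by rewrite cLnorm_indic// B0 poweR0r// invr_neq0// gt_eqF.
by rewrite cLnorm_indic// B0 poweR_lty.
Qed.

(** Over the E k contained in B the mean of the indicator of B is 1, unless E k
    is null, in which case chi (E k) is 0. *)
Lemma cond_exp_chi (B : set T) : measurable B -> (mu B < +oo)%E ->
  (forall k, E k `<=` B \/ E k `&` B = set0) -> B `<=` \bigcup_k E k ->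
  cond_exp (chi B) = chi B.
Proof.
move=> mB Boo EB Bcov; have mI := cmeasurable_indic R mB.
pose c k : R[i] := (`[< E k `<=` B >])%:R.
have locE k : local_integral (E k) (chi B) = c k * (v k)%:C.
  rewrite /local_integral.
  have [_ cv] := cintegral_indic (R := R) (mE k) (Eoo k); rewrite -/(v k) in cv.
  have ci := (cintegral_indic (R := R) (mE k) (Eoo k)).1.
  rewrite -cv -cintegralZ//; apply: cintegral_ae_eq.
  - by apply: cmeasurableM; [exact: cmeasurable_indic|exact: Lp_meas].
  - by apply: cmeasurableM; [exact: cmeasurable_cst|exact: cmeasurable_indic].
  apply: ae_imply (chi_repr mB Boo) => t -> _; rewrite /c !indicE.
  have [tk|tk] := boolP (t \in E k); rewrite /= ?mul0r ?mulr0// mul1r mulr1.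
  move: tk; rewrite inE => tk; congr (_%:R); congr nat_of_bool.
  case: (EB k) => [sub|dis].
    by rewrite mem_set ?asboolT//; exact: sub.
  rewrite memNset ?asboolF// => [sub|Bt].
    by rewrite -[False]/(set0 t) -dis; split => //; exact: sub.
  by rewrite -[False]/(set0 t) -dis.
have -> : cond_exp (chi B) = \sum_k c k *: chi (E k).
  apply: eq_bigr => k _; rewrite /mean locE -/(v k).
  have [v0|v0] := eqVneq (v k) 0.
    by rewrite chi_null ?scaler0// vE v0.
  by rewrite mulrCA -rmorphM/= mulVf// mulr1.
apply: Lp_eq_ae.
have h := Lp_repr_sum (index_enum K) c (fun k => chi (E k)).
have h' : {ae mu, forall t, forall k, Lp_repr (chi (E k)) t = \1_(E k) t}.
  by apply: filter_forall => k; exact: chi_repr.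
have h'' := chi_repr mB Boo.
near=> t; rewrite (near h t)// (near h'' t)//.
under eq_bigr do rewrite (near h' t)//.
have [[k Ek]|nE] := pselect (exists k, E k t); last first.
  rewrite sum_indic_out; last by move=> k Ek; apply: nE; exists k.
  by rewrite indicE memNset// => /Bcov[k _ Ek]; apply: nE; exists k.
rewrite (sum_indic_in _ Ek) /c indicE; congr (_%:R); congr nat_of_bool.
case: (EB k) => [sub|dis]; first by rewrite mem_set ?asboolT//; exact: sub.
rewrite memNset ?asboolF// => [sub|Bt].
  by rewrite -[False]/(set0 t) -dis; split => //; exact: sub.
by rewrite -[False]/(set0 t) -dis.
Unshelve. all: by end_near. Qed.

End ConditionalExpectation.
(** * Simple vectors *)

Section SimpleVectors.
Context (R : realType).
Local Notation TR := (measurableTypeR R).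
Local Notation mu := (@haar R).

Definition bounded_away (B : set TR) := measurable B /\ exists n, B `<=` annulus n.

Lemma bounded_away_fin (B : set TR) : bounded_away B -> (mu B < +oo)%E.
Proof. by move=> [mB [n Bn]]; exact: sub_annulus_fin Bn. Qed.

Definition disjoint_family (K : finType) (E : K -> set TR) :=
  (forall k, bounded_away (E k)) /\ trivIset setT E.

Definition refines (K : finType) (E : K -> set TR) (L : seq (set TR)) :=
  forall B, B \in L ->
    (forall k, E k `<=` B \/ E k `&` B = set0) /\ B `<=` \bigcup_k E k.

Lemma refines_cat (K : finType) (E : K -> set TR) L L' :
  refines E (L ++ L') -> refines E L /\ refines E L'.
Proof. by move=> h; split=> B BL; apply: h; rewrite mem_cat BL ?orbT. Qed.

(** The atoms of the finite algebra of sets generated by L. *)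
Lemma exists_refinement (L : seq (set TR)) : (forall B, B \in L -> bounded_away B) ->
  exists (K : finType) (E : K -> set TR), disjoint_family E /\ refines E L.
Proof.
move=> admL; pose A (i : 'I_(size L)) := nth set0 L i.
have AL i : A i \in L by exact: mem_nth.
have mA i : measurable (A i) by case: (admL _ (AL i)).
pose E (k : {ffun 'I_(size L) -> bool}) : set TR :=
  (\bigcap_(i in setT) (if k i then A i else ~` A i)) `&` \bigcup_(i in setT) A i.
have memE k t i : E k t -> A i t <-> k i.
  by move=> [/(_ i I) h _]; case: (k i) h => h; split.
exists {ffun 'I_(size L) -> bool}, E; split; [split|].
- move=> k; split.
    apply: measurableI.
      apply: fin_bigcap_measurable; first exact: finite_finset.
      by move=> i _; case: ifP => _ //; exact: measurableC.
    by apply: fin_bigcup_measurable; first exact: finite_finset.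
  have /choice[n An] : forall i : 'I_(size L), exists n, A i `<=` annulus n.
    by move=> i; case: (admL _ (AL i)).
  exists (\max_i n i) => t [_ [i _ /An]]; apply: nondecreasing_annulus.
  exact: leq_bigmax.
- move=> k j _ _ [t [Ek Ej]]; apply/ffunP => i.
  by apply/idP/idP => [/(memE _ _ _ Ek)/(memE _ _ _ Ej)|/(memE _ _ _ Ej)/(memE _ _ _ Ek)].
move=> B BL; pose i : 'I_(size L) := Ordinal (etrans (index_mem B L) BL).
have Bi : B = A i by rewrite /A /= nth_index.
split.
  move=> k; have [ki|ki] := boolP (k i).
    by left => t Et; rewrite Bi; apply/(memE k t i Et).
  by right; rewrite -subset0 => t [Et]; rewrite Bi => /(memE k t i Et); exact/negP.
move=> t Bt; exists [ffun j => `[< A j t >]] => //; split.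
  by move=> j _; rewrite ffunE; case: asboolP.
by exists i; rewrite -?Bi.
Qed.

Section OneExponent.
Context (p q : R) (p1 : 1 <= p).
Hypotheses (q0 : 0 < q) (pq : p^-1 + q^-1 = 1).
Local Notation X := (LpRx p1).

Let p0 : 0 < p. Proof. exact: lt_le_trans p1. Qed.

(** Stands for the linear span of the indicators of bounded_away sets, whose
    elements satisfy it; what the proof of injectivity uses is that all fine
    enough conditional expectations fix the vector. *)
Definition simple_vector (x : X) := exists L : seq (set TR),
  (forall B, B \in L -> bounded_away B) /\
  forall (K : finType) (E : K -> set TR), disjoint_family E -> refines E L ->
    cond_exp E x = x.

Lemma simple_vector_chi (B : set TR) : bounded_away B -> simple_vector (chi mu p1 B).
Proof.
move=> aB; exists [:: B]; split=> [C|K E [aE tE] /(_ B)].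
  by rewrite inE => /eqP ->.
rewrite inE eqxx => /(_ isT)[EB Bcov].
apply: cond_exp_chi => //.
- by move=> k; case: (aE k).
- by move=> k; exact: bounded_away_fin.
- by case: aB.
- exact: bounded_away_fin.
Qed.

Lemma simple_vector_linear a (x y : X) :
  simple_vector x -> simple_vector y -> simple_vector (a *: x + y).
Proof.
move=> [L [aL xL]] [L' [aL' yL']]; exists (L ++ L'); split.
  by move=> B; rewrite mem_cat => /orP[/aL|/aL'].
move=> K E dE /refines_cat[rL rL']; have [aE _] := dE.
rewrite (cond_exp_linear q0 pq) ?xL ?yL'// => k; first by case: (aE k).
exact: bounded_away_fin.
Qed.

Lemma simple_vector0 : simple_vector 0.
Proof.
have h : simple_vector (chi mu p1 set0).
  by apply: simple_vector_chi; split => //; exists 0%N.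
by have := simple_vector_linear (-1) h h; rewrite scaleN1r addNr.
Qed.

Lemma simple_vector_sum I (s : seq I) (a : I -> R[i]) (z : I -> X) :
  (forall i, simple_vector (z i)) -> simple_vector (\sum_(i <- s) a i *: z i).
Proof.
move=> sz; elim: s => [|i s ih]; first by rewrite big_nil; exact: simple_vector0.
by rewrite big_cons; exact: simple_vector_linear.
Qed.

Definition approximable (x : X) :=
  forall e, 0 < e -> exists2 y, simple_vector y & rnorm (x - y) < e.

Lemma approximable_linear a x y :
  approximable x -> approximable y -> approximable (a *: x + y).
Proof.
move=> ax ay e e0.
have na : 0 < normc a + 1 by rewrite ltr_wpDl// normc_ge0.
have e1 : 0 < e / 2 / (normc a + 1) by rewrite !divr_gt0.
have e2 : 0 < e / 2 by rewrite divr_gt0.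
have [x' sx xx'] := ax _ e1; have [y' sy yy'] := ay _ e2.
exists (a *: x' + y'); first exact: simple_vector_linear.
have -> : a *: x + y - (a *: x' + y') = a *: (x - x') + (y - y').
  by rewrite scalerBr opprD addrACA.
rewrite (le_lt_trans (rnormD _ _))// (splitr e) ltr_leD ?ltW// rnormZ.
apply: (@le_lt_trans _ _ ((normc a + 1) * rnorm (x - x'))).
  by rewrite ler_wpM2r ?rnorm_ge0// lerDl.
by rewrite mulrC -ltr_pdivlMr.
Qed.

Import HBNNSimple.

(** Truncated dyadic approximations from below converge in L^p by dominated
    convergence. *)
Lemma approximable_nonneg (f : TR -> R) : measurable_fun setT f -> (forall t, 0 <= f t) ->
  (cLnorm mu p (fun t => (f t)%:C) < +oo)%E -> approximable (Lp_of mu p1 (fun t => (f t)%:C)).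
Proof.
move=> mf f0 foo.
have mfE : measurable_fun setT (EFin \o f) by exact/measurable_EFinP.
pose s n : {nnsfun TR >-> R} := nnsfun_approx measurableT mfE n.
have sf n t : s n t <= f t.
  rewrite -lee_fin /s nnsfun_approxE.
  by apply: (@le_approx _ _ _ setT (EFin \o f)) => // x _; rewrite lee_fin.
have s0 n t : 0 <= s n t by exact: fun_ge0.
pose g n t : R := s n t * \1_(annulus n) t.
have mI n : measurable_fun setT (\1_(annulus n) : TR -> R).
  by apply: measurable_indic; exact: measurable_annulus.
have mg n : measurable_fun setT (g n) by exact: measurable_funM.
have g0 n t : 0 <= g n t by rewrite mulr_ge0.
have gf n t : g n t <= f t.
  rewrite /g indicE; case: (_ \in _); rewrite ?mulr1 ?mulr0//.
have cvg_g t : g n t @[n --> \oo] --> f t.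
  have [k _ kt] : (\bigcup_n annulus n) t by rewrite bigcup_annulus.
  have c : s n t @[n --> \oo] --> f t.
    have /fine_cvg := @cvg_nnsfun_approx _ _ _ _ measurableT _ mfE (fun x _ => f0 x) t I.
    exact.
  apply: cvg_trans c; apply: near_eq_cvg; exists k => // n /= kn.
  by rewrite /g indicE mem_set ?mulr1//; apply: nondecreasing_annulus kn _ kt.
have mC (h : TR -> R) : measurable_fun setT h -> cmeasurable (fun t => (h t)%:C).
  exact: cmeasurable_real.
have fpow : (\int[mu]_t (f t `^ p)%:E < +oo)%E.
  have : (cLnorm mu p (fun t => (f t)%:C) `^ p < +oo)%E by rewrite poweR_lty.
  rewrite cLnormE -poweRrM mulVf ?gt_eqF// poweRe1.
    by under eq_integral do rewrite normc_real ger0_norm//.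
  by apply: integral_ge0 => t _; rewrite lee_fin powR_ge0.
have goo n : (cLnorm mu p (fun t => (g n t)%:C) < +oo)%E.
  apply: le_lt_trans foo; apply: cLnorm_mono => // [|t]; first exact: mC.
  by rewrite !normc_real !ger0_norm.
move=> e e0.
have [] := @dominated_convergence _ _ _ mu setT measurableT
  (fun n t => ((f t - g n t) `^ p)%:E) (cst 0%E) (fun t => (f t `^ p)%:E).
- move=> n; apply/measurable_EFinP; apply: (measurableT_comp (measurable_powR _)).
  exact: measurable_funB.
- exact: measurable_cst.
- apply: aeW => t _; apply: cvg_EFin; first exact: nearW.
  apply/cvgrPdist_lt => r r0.
  have r1 : 0 < Num.min r 1 by rewrite lt_min r0 ltr01.
  move/cvgrPdist_lt : (cvg_g t) => /(_ _ r1); apply: filterS => n /=.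
  set h := f t - g n t; have h0 : 0 <= h by rewrite subr_ge0.
  rewrite ger0_norm// lt_min sub0r normrN (ger0_norm (powR_ge0 _ _)) => /andP[hr h1].
  have [->|hn0] := eqVneq h 0; first by rewrite powR0 ?gt_eqF.
  have hp : 0 < h by rewrite lt_neqAle eq_sym hn0.
  apply: le_lt_trans hr; rewrite -[leRHS]powRr1//.
  by rewrite ger_powR// hp ltW.
- apply/integrableP; split.
    by apply/measurable_EFinP; apply: (measurableT_comp (measurable_powR _)).
  by under eq_integral do rewrite gee0_abs ?lee_fin ?powR_ge0//.
- apply: aeW => t n _; rewrite /= lee_fin ger0_norm ?powR_ge0//.
  by rewrite ge0_ler_powR ?nnegrE ?subr_ge0 ?(ltW p0)// gerBl.
move=> _ _; rewrite integral0 => int0.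
have e2 : 0 < e / 2 by rewrite divr_gt0.
have [n nle] : exists n, (\int[mu]_t ((f t - g n t) `^ p)%:E <= ((e / 2) `^ p)%:E)%E.
  have /fine_cvgP[[k1 _ k1P] /cvgrPdist_lt/(_ ((e / 2) `^ p))] := int0.
  case=> [|k2 _ /(_ (maxn k1 k2) (leq_maxr _ _))]; first by rewrite powR_gt0.
  have fin : (\int[mu]_t ((f t - g (maxn k1 k2) t) `^ p)%:E)%E \is a fin_num.
    exact: k1P (leq_maxl _ _).
  rewrite sub0r normrN => h; exists (maxn k1 k2).
  rewrite -(fineK fin) lee_fin; apply: le_trans (ltW h); exact: ler_norm.
exists (Lp_of mu p1 (fun t => (g n t)%:C)).
  have bai (y : R) : bounded_away (s n @^-1` [set y] `&` annulus n).
    split; last by exists n => t [].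
    by apply: measurableI; [exact: measurable_sfunP|exact: measurable_annulus].
  have [N [c sE]] : exists N (c : 'I_N -> R), forall t,
      s n t = \sum_(i < N) c i * \1_(s n @^-1` [set c i]) t.
    by eexists; eexists; exact: fimfunEord.
  pose A i := s n @^-1` [set c i] `&` annulus n.
  have -> : Lp_of mu p1 (fun t => (g n t)%:C) = \sum_(i < N) (c i)%:C *: chi mu p1 (A i).
    apply: Lp_eq_ae; have h1 := Lp_of_repr p1 (mC _ (mg n)) (goo n).
    have h2 := Lp_repr_sum (index_enum 'I_N) (fun i => (c i)%:C : R[i])
      (fun i => chi mu p1 (A i)).
    have h3 : {ae mu, forall t, forall i : 'I_N, Lp_repr (chi mu p1 (A i)) t = \1_(A i) t}.
      apply: filter_forall => i; apply: chi_repr; first by case: (bai (c i)).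
      exact: bounded_away_fin (bai (c i)).
    near=> t; rewrite (near h1 t)// (near h2 t)//.
    under eq_bigr do rewrite (near h3 t)//.
    rewrite /g sE mulr_suml rmorph_sum/=; apply: eq_bigr => i _.
    rewrite -mulrA rmorphM/=; congr (_ * _).
    rewrite /A !indicE [in RHS]in_setI.
    by case: (t \in s n @^-1` _); case: (t \in annulus n); rewrite /= ?mulr1 ?mulr0 ?mul0r.
  by apply: simple_vector_sum => i; exact: simple_vector_chi (bai (c i)).
apply: (@le_lt_trans _ _ (e / 2)); last by rewrite ltr_pdivrMr// ltr_pMr// ltr1n.
rewrite -lee_fin rnorm_Lp cLnormE.
rewrite (_ : (\int[mu]_t _)%E = \int[mu]_t ((f t - g n t) `^ p)%:E)%E; last first.
  apply: ge0_ae_eq_integral => //.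
  - apply/measurable_EFinP; apply: (measurableT_comp (measurable_powR _)).
    exact/measurable_normc/Lp_meas.
  - apply/measurable_EFinP; apply: (measurableT_comp (measurable_powR _)).
    exact: measurable_funB.
  - by move=> t _; rewrite lee_fin powR_ge0.
  - by move=> t _; rewrite lee_fin powR_ge0.
  have h1 := Lp_of_repr p1 (mC _ (mg n)) (goo n).
  have h2 := Lp_of_repr p1 (mC _ mf) foo.
  have h3 := Lp_repr_lin (-1) (Lp_of mu p1 (fun t => (g n t)%:C)) (Lp_of mu p1 (fun t => (f t)%:C)).
  near=> t => _; rewrite addrC -scaleN1r (near h3 t)// (near h1 t)// (near h2 t)//.
  rewrite mulN1r addrC -rmorphB normc_real ger0_norm// subr_ge0; exact: gf.
have -> : ((e / 2)%:E = ((e / 2) `^ p)%:E `^ p^-1)%E.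
  by rewrite poweR_EFin -powRrM mulfV ?gt_eqF// powRr1// ltW.
apply: gt0_ler_poweR nle; first by rewrite invr_ge0 ltW.
- by rewrite in_itv/= leey andbT; apply: integral_ge0 => t _; rewrite lee_fin powR_ge0.
- by rewrite in_itv/= leey andbT lee_fin powR_ge0.
Unshelve. all: by end_near. Qed.

(** Any vector is a combination of the positive and negative parts of its real
    and imaginary parts. *)
Lemma simple_vector_dense x : approximable x.
Proof.
have xoo : (cLnorm mu p (Lp_repr x) < +oo)%E by rewrite -rnorm_Lp ltry.
have [mr mi] := Lp_meas x.
have part (h : R -> R) (c : R[i] -> R) : (forall z, `|c z| <= normc z) ->
    measurable_fun setT h -> (forall y, 0 <= h y <= `|y|) ->
    measurable_fun setT (fun t => c (Lp_repr x t)) ->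
    approximable (Lp_of mu p1 (fun t => (h (c (Lp_repr x t)))%:C)) /\
    {ae mu, forall t, Lp_repr (Lp_of mu p1 (fun t => (h (c (Lp_repr x t)))%:C)) t =
      (h (c (Lp_repr x t)))%:C}.
  move=> cz mh hy mc.
  have mhc : measurable_fun setT (fun t => h (c (Lp_repr x t))) := measurableT_comp mh mc.
  have foo : (cLnorm mu p (fun t => (h (c (Lp_repr x t)))%:C) < +oo)%E.
    apply: le_lt_trans xoo; apply: cLnorm_mono => // t.
    have /andP[h0 h1] := hy (c (Lp_repr x t)).
    by rewrite normc_real ger0_norm// (le_trans h1).
  split; last by apply: Lp_of_repr => //; exact: cmeasurable_real.
  apply: approximable_nonneg => // t.
  by have /andP[] := hy (c (Lp_repr x t)).
pose pos (y : R) := Num.max y 0.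
pose neg (y : R) := Num.max (- y) 0.
have mpos : measurable_fun setT pos by exact: measurable_maxr.
have mneg : measurable_fun setT neg by apply: measurable_maxr => //; exact: measurable_oppr.
have pos_le y : 0 <= pos y <= `|y|.
  by rewrite /pos le_max lexx orbT/= ge_max ler_norm normr_ge0.
have neg_le y : 0 <= neg y <= `|y|.
  by rewrite /neg le_max lexx orbT/= ge_max normr_ge0 andbT -normrN ler_norm.
have decomp y : y = pos y - neg y.
  rewrite /pos /neg; case: (leP y 0) => y0; case: (leP (- y) 0) => y1; lra.
have [a1 r1] := part _ _ (@normRe_le R) mpos pos_le mr.
have [a2 r2] := part _ _ (@normRe_le R) mneg neg_le mr.
have [a3 r3] := part _ _ (@normIm_le R) mpos pos_le mi.
have [a4 r4] := part _ _ (@normIm_le R) mneg neg_le mi.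
set x1 := Lp_of _ _ _ in a1 r1; set x2 := Lp_of _ _ _ in a2 r2.
set x3 := Lp_of _ _ _ in a3 r3; set x4 := Lp_of _ _ _ in a4 r4.
have -> : x = -1 *: x2 + ((- 'i%C) *: x4 + ('i%C *: x3 + x1)).
  apply: Lp_eq_ae.
  have l1 := Lp_repr_lin (-1) x2 ((- 'i%C) *: x4 + ('i%C *: x3 + x1)).
  have l2 := Lp_repr_lin (- 'i%C) x4 ('i%C *: x3 + x1).
  have l3 := Lp_repr_lin 'i%C x3 x1.
  near=> t; rewrite (near l1 t)// (near l2 t)// (near l3 t)//.
  rewrite (near r1 t)// (near r2 t)// (near r3 t)// (near r4 t)//.
  rewrite [LHS]complexE [in LHS](decomp (complex.Re _)) [in LHS](decomp (complex.Im _)).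
  by rewrite !rmorphB; ring.
by do 3 apply: approximable_linear => //.
Unshelve. all: by end_near. Qed.

End OneExponent.
End SimpleVectors.
(** * Injectivity of Psi *)

Section Injectivity.
Context (R : realType) (p q : R) (p1 : 1 <= p) (q1 : 1 <= q).
Hypothesis pq : p^-1 + q^-1 = 1.
Local Notation TR := (measurableTypeR R).
Local Notation mu := (@haar R).
Local Notation X := (LpRx p1).
Local Notation Y := (LpRx q1).
Context (A : completeNormedModType R[i]) (ten : X -> Y -> A).
Context (Psi : A -> affine R -> R[i]).
Hypotheses (Aten : is_projective_tensor ten) (APsi : is_Psi ten Psi).

Let p0 : 0 < p. Proof. exact: lt_le_trans p1. Qed.
Let q0 : 0 < q. Proof. exact: lt_le_trans q1. Qed.
Let qp : q^-1 + p^-1 = 1. Proof. by rewrite addrC. Qed.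
Let bten : bilinear_map ten. Proof. by case: Aten. Qed.

Lemma ten_approximable (x : X) (y : Y) (e : R) : 0 < e ->
  exists x' y', [/\ simple_vector x', simple_vector y' &
    rnorm (ten x y - ten x' y') < e].
Proof.
move=> e0; have ny : 0 < rnorm y + 1 by rewrite ltr_wpDl// rnorm_ge0.
have e1 : 0 < e / 2 / (rnorm y + 1) by rewrite !divr_gt0.
have [x' sx xx'] := simple_vector_dense q0 pq x e1.
have nx : 0 < rnorm x' + 1 by rewrite ltr_wpDl// rnorm_ge0.
have e2 : 0 < e / 2 / (rnorm x' + 1) by rewrite !divr_gt0.
have [y' sy yy'] := simple_vector_dense p0 qp y e2.
exists x', y'; split => //.
have -> : ten x y - ten x' y' = ten (x - x') y + ten x' (y - y').
  by rewrite (bilinearBl bten x x' y) (bilinearBr bten x' y y') addrA subrK.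
rewrite (le_lt_trans (rnormD _ _))// (splitr e) ltr_leD//.
  apply: le_lt_trans (rnorm_ten Aten _ _) _.
  apply: (@le_lt_trans _ _ (rnorm (x - x') * (rnorm y + 1))).
    by rewrite ler_wpM2l ?rnorm_ge0// lerDl.
  by rewrite -ltr_pdivlMr.
apply: le_trans (rnorm_ten Aten _ _) _.
apply: (@le_trans _ _ (rnorm (y - y') * (rnorm x' + 1))).
  by rewrite mulrC ler_wpM2l ?rnorm_ge0// lerDl.
by rewrite -ler_pdivlMr// ltW.
Qed.

(** Concatenation of the lists of sets attached to the simple vectors gives one
    list that serves the whole sum. *)
Lemma tensor_sum_approximable (s : seq (X * Y)) (e : R) : 0 < e ->
  exists s' L, [/\ rnorm (tensor_sum ten s - tensor_sum ten s') < e,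
    forall B, B \in L -> bounded_away B &
    forall (K : finType) (E : K -> set TR), disjoint_family E -> refines E L ->
      forall w, w \in s' -> cond_exp E w.1 = w.1 /\ cond_exp E w.2 = w.2].
Proof.
elim: s e => [|w s ih] e e0.
  by exists [::], [::]; split=> //; rewrite subrr rnorm0.
have e2 : 0 < e / 2 by rewrite divr_gt0.
have [s' [L [ss' aL Ls']]] := ih _ e2.
have [x' [y' [[Lx [ax Lx']] [Ly [ay Ly']] ww']]] := ten_approximable w.1 w.2 e2.
exists ((x', y') :: s'), (Lx ++ Ly ++ L); split.
- rewrite /tensor_sum !big_cons opprD addrACA (le_lt_trans (rnormD _ _))//.
  by rewrite (splitr e) ltr_leD// ltW.
- by move=> B; rewrite !mem_cat => /or3P[/ax|/ay|/aL].
- move=> K E dE /refines_cat[rx /refines_cat[ry rL]] v.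
  rewrite inE => /predU1P[->|vs]; last exact: Ls' dE rL _ vs.
  by rewrite /= Lx'// Ly'.
Qed.

Section Kernel.
Context (u : A).
Hypothesis Psiu : Psi u = fun=> 0.

(** Conditional expectations on both factors annihilate u: they are given by
    finitely many products of integrals over bounded sets. *)
Lemma vanishing_cond_exp (K : finType) (E : K -> set TR) : disjoint_family E ->
  vanishes_at ten (fun (x : X) (y : Y) => ten (cond_exp E x) (cond_exp E y)) 1 u.
Proof.
move=> [aE tE].
have mE k : measurable (E k) by case: (aE k).
have Eoo k : (mu (E k) < +oo)%E := bounded_away_fin (aE k).
have bil : bilinear_map (fun (x : X) (y : Y) => ten (cond_exp E x) (cond_exp E y)).
  split=> [x c y y'|y c x x'].
    by rewrite (cond_exp_linear p0 qp)// (bilinearDr bten) (bilinearZr bten).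
  by rewrite (cond_exp_linear q0 pq)// (bilinearDl bten) (bilinearZl bten).
have bound (x : X) (y : Y) :
    rnorm (ten (cond_exp E x) (cond_exp E y)) <= 1 * (rnorm x * rnorm y).
  rewrite mul1r (le_trans (rnorm_ten Aten _ _))// ler_pM ?rnorm_ge0//.
    exact: (cond_exp_contraction q0 pq).
  exact: (cond_exp_contraction p0 qp).
suff [M v] : exists M, vanishes_at ten
    (fun (x : X) (y : Y) => ten (cond_exp E x) (cond_exp E y)) M u.
  exact: (vanishes_sharpen Aten bil ler01 bound v).
have -> : (fun (x : X) (y : Y) => ten (cond_exp E x) (cond_exp E y)) =
    fun x y => \sum_k \sum_l (((fine (mu (E k)))^-1)%:C * ((fine (mu (E l)))^-1)%:C *
      (local_integral (E k) x * local_integral (E l) y)) *: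
      ten (chi mu p1 (E k)) (chi mu q1 (E l)).
  apply/funext => x; apply/funext => y.
  rewrite /cond_exp (bilinear_suml bten); apply: eq_bigr => k _.
  rewrite (bilinear_sumr bten); apply: eq_bigr => l _.
  rewrite (bilinearZl bten) (bilinearZr bten) scalerA; congr (_ *: _).
  by rewrite /mean mulrACA.
apply: vanishes_sum => k; apply: vanishes_sum => l.
have [_ [n En]] := aE k; have [_ [m Em]] := aE l.
have [M v] := vanishing_product (n := maxn n m) pq Aten APsi Psiu (mE k) (mE l)
  (subset_trans En (nondecreasing_annulus (leq_maxl n m)))
  (subset_trans Em (nondecreasing_annulus (leq_maxr n m))).
by eexists; exact: (vanishes_scale _ _ v).
Qed.

(** A finite sum of tensors of simple vectors is its own conditional
    expectation, and conditional expectations annihilate u; so if the sum is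
    close to u, then it is small, and so is u. *)
Lemma Psi_kernel : u = 0.
Proof.
apply: rnorm_eq0; apply/eqP; rewrite eq_le rnorm_ge0 andbT.
apply/ler_addgt0Pl => e e0; rewrite addr0.
have e4 : 0 < e / 4%:R by rewrite divr_gt0.
have [s su] := tensor_sum_dense Aten u e4.
have [s' [L [ss' aL Ls']]] := tensor_sum_approximable s e4.
have [K [E [dE rE]]] := exists_refinement aL.
have s'E : tensor_sum (fun (x : X) (y : Y) => ten (cond_exp E x) (cond_exp E y)) s' =
    tensor_sum ten s'.
  rewrite /tensor_sum; apply: eq_big_seq => w ws.
  by have [-> ->] := Ls' K E dE rE w ws.
have h := vanishing_cond_exp dE s'; rewrite s'E mul1r in h.
have s'u : rnorm (tensor_sum ten s' - u) <= e / 4%:R + e / 4%:R.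
  apply: le_trans (rnorm_dist_trans _ (tensor_sum ten s) _) _.
  by rewrite lerD// ?(ltW su)// rnormBC ltW.
rewrite -[u](subKr (tensor_sum ten s')) (le_trans (rnormB _ _))//.
apply: (@le_trans _ _ ((e / 4%:R + e / 4%:R) + (e / 4%:R + e / 4%:R))).
  by rewrite lerD// (le_trans h).
by rewrite le_eqVlt; apply/orP; left; apply/eqP; field.
Qed.

End Kernel.

Lemma Psi_injective : injective Psi.
Proof.
move=> u v uv; apply/eqP; rewrite -subr_eq0; apply/eqP; apply: Psi_kernel.
by apply/funext => g; rewrite (PsiB APsi) uv subrr.
Qed.

End Injectivity.

(** * Banach algebra structures *)

Section BanachAlgebras.
Context (R : realType).

Lemma rnorm_complete (V : completeNormedModType R[i]) (v : nat -> V) :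
  (forall e : R, 0 < e -> exists n0, forall m n, (n0 <= m)%N -> (n0 <= n)%N ->
    rnorm (v m - v n) < e) ->
  exists l, rnorm (v n - l) @[n --> \oo] --> (0 : R).
Proof.
move=> cv; have : cvg (v @ \oo).
  apply: cauchy_cvg; apply: cauchy_exP => e e0.
  have [r eE] : exists r : R, e = r%:C.
    move: e0; rewrite ltcE => /andP[/eqP ei _]; exists (complex.Re e).
    by apply/eqP; rewrite eq_complex/= ei !eqxx.
  move: e0; rewrite eE ltcR => r0; have [n0 h] := cv _ r0.
  exists (v n0); exists n0 => // n /= n0n.
  by rewrite -ball_normE/= rnormE ltcR h.
by move=> /cvg_ex[l vl]; exists l; exact: cvg_rnorm.
Qed.

Lemma Banach_algebra_transport (V W : lmodType R[i]) (N : V -> R) (mul : V -> V -> V)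
    (N' : W -> R) (mul' : W -> W -> W) (f : V -> W) :
  is_comm_Banach_algebra [set: V] N mul -> linear f -> injective f ->
  (forall u v, f (mul u v) = mul' (f u) (f v)) -> (forall u, N' (f u) = N u) ->
  is_comm_Banach_algebra (range f) N' mul'.
Proof.
move=> cV lin inj fM fN.
have f0 : f 0 = 0.
  by have := lin 1 0 0; rewrite !scale1r addr0 -[LHS]addr0 => /addrI.
have fB u v : f (u - v) = f u - f v.
  by rewrite -scaleN1r addrC lin scaleN1r addrC.
have fZ a u : f (a *: u) = a *: f u by have := lin a u 0; rewrite f0 !addr0.
have fD u v : f (u + v) = f u + f v by have := lin 1 u v; rewrite !scale1r.
split.
- by exists 0.
- by move=> a _ _ [u _ <-] [v _ <-]; exists (a *: u + v) => //; exact: lin.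
- by move=> _ [u _ <-]; rewrite fN; exact: cba_norm_ge0 cV _ _.
- by move=> _ [u _ <-]; rewrite fN => /(cba_norm_eq0 cV I) ->.
- by move=> a _ [u _ <-]; rewrite -fZ !fN; exact: cba_normZ cV _ _ _.
- by move=> _ _ [u _ <-] [v _ <-]; rewrite -fD !fN; exact: cba_normD cV _ _ _ _.
- move=> w fw; have /choice[v vw] : forall n, exists v, f v = w n.
    by move=> n; case: (fw n) => v _; exists v.
  move=> cw; have [|l _ vl] := cba_complete cV (u := v) (fun=> I).
    move=> e /cw[n0 h]; exists n0 => m n hm hn.
    by rewrite -fN fB !vw; exact: h.
  exists (f l); first by exists l.
  by under eq_fun do rewrite -vw -fB fN.
- by move=> _ _ [u _ <-] [v _ <-]; exists (mul u v).
- move=> a _ _ _ [u _ <-] [v _ <-] [w _ <-].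
  by rewrite -lin -!fM (cba_mulDl cV)// lin.
- by move=> _ _ _ [u _ <-] [v _ <-] [w _ <-]; rewrite -!fM (cba_mulA cV).
- by move=> _ _ [u _ <-] [v _ <-]; rewrite -!fM (cba_mulC cV).
- by move=> _ _ [u _ <-] [v _ <-]; rewrite -!fM !fN; exact: cba_normM cV _ _ _ _.
Qed.

End BanachAlgebras.

Theorem theorem6p2 (R : realType) (p q : R) (p1 : 1 < p) (q1 : 1 < q)
    (pq : p^-1 + q^-1 = 1)
    (A : completeNormedModType R[i])
    (ten : LpRx (ltW p1) -> LpRx (ltW q1) -> A)
    (boxtimes : A -> A -> A)
    (Psi : A -> (affine R -> R[i]))
    (Aten : is_projective_tensor ten)
    (Abox : is_boxtimes ten boxtimes)
    (APsi : is_Psi ten Psi) :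
  injective Psi /\
  [/\ is_comm_Banach_algebra [set: A] (@rnorm R A) boxtimes,
      is_comm_Banach_algebra (range Psi) (quotient_norm Psi) (@ptwise_mul R) &
      is_isometric_algebra_iso [set: A] (@rnorm R A) boxtimes
        (range Psi) (quotient_norm Psi) (@ptwise_mul R) Psi].
Proof.
have inj : injective Psi := Psi_injective pq Aten APsi.
have PsiM u v : Psi (boxtimes u v) = ptwise_mul (Psi u) (Psi v).
  exact: (Psi_box pq Aten Abox APsi).
have [bbox box1 _] := Abox; have [lin _ _ _] := APsi.
have normE u : quotient_norm Psi (Psi u) = rnorm u.
  rewrite /quotient_norm (_ : [set v | Psi v = Psi u] = [set u]).
    by rewrite image_set1 inf1.
  by apply/seteqP; split => [v /inj|v ->].
have algA : is_comm_Banach_algebra [set: A] (@rnorm R A) boxtimes.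
  split => //.
  - by move=> u _; exact: rnorm_ge0.
  - by move=> u _; exact: rnorm_eq0.
  - by move=> a u _; exact: rnormZ.
  - by move=> u v _ _; exact: rnormD.
  - by move=> u _ /rnorm_complete[l ul]; exists l.
  - by move=> a u v w _ _ _; rewrite (bilinearDl bbox) (bilinearZl bbox).
  (* associativity and commutativity are those of the pointwise product *)
  - move=> u v w _ _ _; apply: inj; rewrite !PsiM.
    by apply/funext => g; exact: mulrA.
  - move=> u v _ _; apply: inj; rewrite !PsiM.
    by apply/funext => g; exact: mulrC.
split => //; split => //.
  exact: (Banach_algebra_transport algA lin inj PsiM normE).
split => [|a u v _ _|//|//]; last exact: lin.
by split=> [u _|u v _ _ /inj|_ [u _ <-]] //; exists u.
Qed.
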